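(* Let $m>0$. There exist constants $0<C_1\le C_2$, independent of $N$ and $c$, such that the following holds for every fixed $N>0$, where $c$ satisfies $0<N^{2/3}<cN_*^{2/3}$, $\rho_c$ is a nonnegative minimizer of $E_c(N)$ with compact support of radius $R_c$, and $\rho_\infty$ is a nonnegative minimizer of $E_\infty(N)$ with compact support of radius $R_\infty$: (i) $C_1N^2\le\|\rho_\infty\|_{L^\infty(\mathbb{R}^3)}\le C_2N^2$ and $C_1N^{-1/3}\le R_\infty\le C_2N^{-1/3}$; (ii) for all $c$ large enough (depending on $N$), $C_1N^2\le\|\rho_c\|_{L^\infty(\mathbb{R}^3)}\le C_2N^2$ and $C_1N^{-1/3}\le R_c\le C_2N^{-1/3}$.
   Context: Fix constants $\kappa>0$ and $q\ge 1$. For a density $\rho\ge 0$ on $\mathbb{R}^3$ put $$j_{mc}(\rho(x))=\frac{q}{8\pi^3}\int_{|p|<(6\pi^2\rho(x)/q)^{1/3}}\left(\sqrt{c^2|p|^2+m^2c^4}-mc^2\right)dp,\qquad D(\rho,\rho)=\frac12\int_{\mathbb{R}^3}\int_{\mathbb{R}^3}\frac{\rho(x)\rho(y)}{|x-y|}\,dxdy,$$ $$j_\infty(\rho(x))=\frac{q}{8\pi^3}\int_{|p|<(6\pi^2\rho(x)/q)^{1/3}}\frac{|p|^2}{2m}\,dp=\frac{3}{10m}\Big(\frac{6\pi^2}{q}\Big)^{2/3}\rho(x)^{5/3},$$ where $p\in\mathbb{R}^3$. Define $\mathcal{E}_c(\rho)=\int_{\mathbb{R}^3}j_{mc}(\rho(x))\,dx-\kappa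 D(\rho,\rho)$ and $\mathcal{E}_\infty(\rho)=\int_{\mathbb{R}^3}j_\infty(\rho(x))\,dx-\kappa D(\rho,\rho)$, and $$E_c(N)=\inf\Big\{\mathcal{E}_c(\rho):0\le\rho\in L^1\cap L^{4/3}(\mathbb{R}^3),\ \int_{\mathbb{R}^3}\rho\,dx=N\Big\},$$ $$E_\infty(N)=\inf\Big\{\mathcal{E}_\infty(\rho):0\le\rho\in L^1\cap L^{5/3}(\mathbb{R}^3),\ \int_{\mathbb{R}^3}\rho\,dx=N\Big\}.$$ A minimizer of $E_c(N)$ (resp. $E_\infty(N)$) is an admissible $\rho$ attaining the infimum. The constant $N_*>0$ is the optimal (largest) constant such that $$\kappa N_*^{2/3}D(\rho,\rho)\le K_{cl}\|\rho\|_{L^{4/3}}^{4/3}\|\rho\|_{L^1}^{2/3}\quad\text{for all }0\le\rho\in L^1\cap L^{4/3}(\mathbb{R}^3),\qquad K_{cl}=\frac34\Big(\frac{6\pi^2}{q}\Big)^{1/3}.$$ The minimizers are taken to be symmetric decreasing (radial about the origin and nonincreasing in $|x|$) with compact support, so their supports are closed balls centered at the origin, of radius $R_c$, resp. $R_\infty$. *)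

(* Defs.v *)
From HB Require Import structures.
From mathcomp Require Import all_boot all_order all_algebra.
From mathcomp Require Import all_classical all_reals all_analysis.

Set Implicit Arguments.
Unset Strict Implicit.
Unset Printing Implicit Defensive.

Import Order.TTheory GRing.Theory Num.Theory.
Import numFieldNormedType.Exports.

Local Open Scope classical_set_scope.
Local Open Scope ring_scope.

(* measurableTypeR R is R with its Borel sets. *)
Notation R3 R := (measurableTypeR R * measurableTypeR R * measurableTypeR R)%type.

Definition leb3 (R : realType) : {measure set (R3 R) -> \bar R} :=
  ((@lebesgue_measure R \x @lebesgue_measure R) \x @lebesgue_measure R)%E.

(* The norm `|x| that R * R * R carries in the library is the sup norm. *)
Definition enorm (R : realType) (x : R3 R) : R :=
  Num.sqrt (x.1.1 ^+ 2 + x.1.2 ^+ 2 + x.2 ^+ 2).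

Definition edist (R : realType) (x y : R3 R) : R :=
  enorm (x.1.1 - y.1.1, x.1.2 - y.1.2, x.2 - y.2).

Section ThomasFermi.
Context {R : realType}.
Implicit Types (q kappa m c s N : R) (rho : R3 R -> R).

(* Kinetic energy density of a free Fermi gas of density s with q spin states
   and one-particle dispersion tau. *)
Definition fermi_density q (tau : R3 R -> R) s : \bar R :=
  ((q / (8 * pi ^+ 3))%:E *
   \int[leb3 R]_(p in [set p | (enorm p < (6 * pi ^+ 2 * s / q) `^ (1 / 3))%R])
     (tau p)%:E)%E.

Definition j_mc q m c s : \bar R :=
  fermi_density q
    (fun p => Num.sqrt (c ^+ 2 * enorm p ^+ 2 + m ^+ 2 * c ^+ 4) - m * c ^+ 2) s.

Definition j_infty q m s : \bar R :=
  fermi_density q (fun p => enorm p ^+ 2 / (2 * m)) s.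

(* D(rho, rho); the diagonal, where the inverse of 0 is 0, is a null set. *)
Definition coulomb rho : \bar R :=
  ((1 / 2)%:E *
   \int[leb3 R]_x \int[leb3 R]_y (rho x * rho y / edist x y)%:E)%E.

Definition energy_c kappa q m c rho : \bar R :=
  (\int[leb3 R]_x j_mc q m c (rho x) - kappa%:E * coulomb rho)%E.

Definition energy_infty kappa q m rho : \bar R :=
  (\int[leb3 R]_x j_infty q m (rho x) - kappa%:E * coulomb rho)%E.

Definition density (p : R) rho : Prop :=
  [/\ forall x, 0 <= rho x, rho \in Lfun (leb3 R) 1%E
    & rho \in Lfun (leb3 R) p%:E].

Definition admissible (p N : R) rho : Prop :=
  density p rho /\ (\int[leb3 R]_x (rho x)%:E)%E = N%:E.

Definition E_c kappa q m c N : \bar R :=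
  ereal_inf [set energy_c kappa q m c rho | rho in admissible (4 / 3) N].

Definition E_infty kappa q m N : \bar R :=
  ereal_inf [set energy_infty kappa q m rho | rho in admissible (5 / 3) N].

Definition minimizer_c kappa q m c N rho : Prop :=
  admissible (4 / 3) N rho /\ energy_c kappa q m c rho = E_c kappa q m c N.

Definition minimizer_infty kappa q m N rho : Prop :=
  admissible (5 / 3) N rho /\ energy_infty kappa q m rho = E_infty kappa q m N.

Definition K_cl q : R := 3 / 4 * (6 * pi ^+ 2 / q) `^ (1 / 3).

Definition coulomb_bound kappa q n : Prop :=
  forall rho, density (4 / 3) rho ->
    ((kappa * n `^ (2 / 3))%:E * coulomb rho <=
     (K_cl q)%:E * 'N[leb3 R]_(4 / 3)%:E [EFin \o rho] `^ (4 / 3)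
                 * 'N[leb3 R]_1 [EFin \o rho] `^ (2 / 3))%E.

Definition is_Nstar kappa q Nstar : Prop :=
  [/\ 0 < Nstar, coulomb_bound kappa q Nstar
    & forall n, 0 < n -> coulomb_bound kappa q n -> n <= Nstar].

(* Densities are considered up to null sets; nothing is asked of the profile g
   at 0, so that an unbounded density is not excluded. *)
Definition symmetric_decreasing rho : Prop :=
  exists g : R -> R,
    (forall r s, 0 < r -> r <= s -> g s <= g r) /\
    {ae leb3 R, forall x, rho x = g (enorm x)}.

(* Complement of the largest open set on which rho vanishes almost everywhere. *)
Definition supp rho : set (R3 R) :=
  [set x | forall U : set (R3 R), nbhs (x : R * R * R) U ->
     ~ {ae leb3 R, forall y, U y -> rho y = 0}].

Definition support_radius rho (r : R) : Prop :=
  0 <= r /\ supp rho = [set x | enorm x <= r].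

End ThomasFermi.

(* Main.v *)
Require Import Defs.
From HB Require Import structures.
From mathcomp Require Import all_boot all_order all_algebra.
From mathcomp Require Import all_classical all_reals all_analysis.
From mathcomp Require Import measurable_realfun ess_sup_inf ring lra.

Import Order.TTheory GRing.Theory Num.Theory.
Import numFieldNormedType.Exports.

Local Open Scope classical_set_scope.
Local Open Scope ring_scope.

(* gives the Euclidean edist precedence over the library function of that name *)
Import Defs.

Set Implicit Arguments.
Unset Strict Implicit.
Unset Printing Implicit Defensive.

(** Write N = n ^ 3.  Both energies are int j(rho) - kappa D(rho, rho), where j is
the Fermi density of a dispersion relation tau.  The estimates rest on three
properties: tau grows at most quadratically under dilations, tau p <= |p| ^ 2 / (2 m),
and tau p >= L |p| - m L ^ 2 for one slope L proportional to n ^ 2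
([dispersion], [steep]).  The last property holds for the relativistic relation as
soon as c > L ([steep_rel]), which is what decides how large c has to be.

A minimizer rho is compared with pieces rho1 <= rho of itself, rescaled to the full
mass.  Since j (b s) <= b ^ 2 j s for
b >= 1 and D is quadratic, a piece of mass N1 satisfies
N1 ^ 2 E(rho) <= N ^ 2 E(rho1) ([sub_energy]).  On the other hand a uniform density
on a cube of side proportional to 1 / n shows that E(rho) <= - e with e a multiple
of n ^ 7 ([trial_energy]).  Four choices then give the four bounds.

Upper bound on the density ([ess_bound_upper]): remove the excess g of rho above
the height u ^ 3.  The kinetic energy drops by at least a multiple of
L (int g ^ (4/3) + u int g), up to a term m L ^ 2 int g.  The attraction drops by the
self-energy of g, which the Coulomb bound dominates by n ^ 2 int g ^ (4/3), and by
the interaction of g with a density of mass n ^ 3 below u ^ 3, which is at most a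
multiple of u n ^ 2 int g because such a density has potential at most 33 u n ^ 2
([potential_bound]).  With L a large enough multiple of n ^ 2 the kinetic terms win,
unless u is at most a multiple of n ^ 2 or g = 0.

Lower bound on the density ([ess_bound_lower]): if rho <= u ^ 3, the same bound on the
potential makes D at most a multiple of u n ^ 5, while kappa D >= e.

Upper bound on the radius ([radius_upper]): removing the mass outside a ball of radius
r, with r below the radius of the support, shows that somewhere outside the ball the
potential is at least a multiple of e / n ^ 3, that is of n ^ 4 ([potential_lower]).
A radially decreasing density satisfies rho(y) <= 64 n ^ 3 / r ^ 3 for |y| >= r / 2
([radial_decay]), so that its potential is at most a multiple of n ^ 3 / r outside the
ball, and r is at most a multiple of 1 / n.

Lower bound on the radius ([radius_lower]): a ball of radius Rad has volume at most
8 Rad ^ 3, and has to carry the mass n ^ 3 with a density of order n ^ 6. *)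

(** * Lebesgue measure on the three-dimensional space *)

Section SigmaFiniteProduct.
Local Open Scope ereal_scope.
Context d1 d2 (T1 : measurableType d1) (T2 : measurableType d2) (R : realType).
Variable m1 : {sigma_finite_measure set T1 -> \bar R}.
Variable m2 : {sigma_finite_measure set T2 -> \bar R}.

Lemma sigma_finite_product : sigma_finite setT (m1 \x m2).
Proof.
have /sigma_finiteP[F [TF ndF Foo]] := sigma_finiteT m1.
have /sigma_finiteP[G [TG ndG Goo]] := sigma_finiteT m2.
exists (fun n => F n `*` G n).
  rewrite -setXTT TF TG predeqE => -[x y]; split => [[/= [n _ Fx] [k _ Gy]]|].
    exists (maxn n k) => //; split => /=.
    - by move: x Fx; exact/subsetPset/ndF/leq_maxl.
    - by move: y Gy; exact/subsetPset/ndG/leq_maxr.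
  by move=> [n _ []/= ? ?]; split; exists n.
move=> k; have [mF Fk] := Foo k; have [mG Gk] := Goo k.
split; first exact: measurableX.
by rewrite product_measure1E// lte_mul_pinfty// ge0_fin_numE.
Qed.

(** Carries the sigma-finiteness that Tonelli's theorem needs when one of the factors
is itself a product. *)
Definition sigma_finite_prod : {sigma_finite_measure set (T1 * T2)%type -> \bar R} :=
  HB.pack_for {sigma_finite_measure set (T1 * T2)%type -> \bar R} (m1 \x m2)
    (Measure_isSigmaFinite.Build _ _ _ (m1 \x m2) sigma_finite_product).

End SigmaFiniteProduct.

Section Lebesgue3.
Context {R : realType}.
Local Open Scope ereal_scope.

Definition sigma_finite_leb3 : {sigma_finite_measure set (R3 R)%type -> \bar R} :=
  sigma_finite_prod (sigma_finite_prod (@lebesgue_measure R) (@lebesgue_measure R)) (@lebesgue_measure R).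

(** The image of mu under phi is mu / k; stated on integrals, so that it passes to
products by Tonelli. *)
Definition scales d (T : measurableType d) (mu : set T -> \bar R) (phi : T -> T) (k : R) :=
  measurable_fun setT phi /\
  forall f : T -> \bar R, measurable_fun setT f -> (forall x, 0 <= f x) ->
    \int[mu]_x f x = k%:E * \int[mu]_x f (phi x).

Lemma scales_lebesgue (a : R) : (0 < a)%R ->
  scales (@lebesgue_measure R) (fun x : measurableTypeR R => a * x)%R a.
Proof.
move=> a0; have mphi := @mulrl_measurable R setT a.
split => // f mf f0.
have mphi' : measurable_fun setT (fun x : measurableTypeR R => (a * x)%R : measurableTypeR R) by [].
pose pf : {measure set (measurableTypeR R) -> \bar R} :=
  pushforward (@lebesgue_measure R) (fun x : measurableTypeR R => (a * x)%R : measurableTypeR R).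
have <- : \int[pf mphi']_x f x = \int[lebesgue_measure]_x f (a * x)%R.
  rewrite /pf ge0_integral_pushforward//.
rewrite -(ge0_integral_mscale (pf mphi') measurableT (NngNum (ltW a0)))//.
apply: eq_measure_integral => A mA _.
(* two measures that agree on half-open intervals are equal *)
apply: lebesgue_measure_unique => // _ [[u v] _ <-].
transitivity (a%:E * lebesgue_measure `](u / a)%R, (v / a)%R]%classic); last first.
  rewrite /mscale/= /pushforward; congr (_ * lebesgue_measure _).
  apply/seteqP; split => x /=; rewrite !in_itv/= ltr_pdivrMr// ler_pdivlMr//.
    by rewrite (mulrC a).
  by rewrite (mulrC a).
rewrite !lebesgue_measure_itv/= !lte_fin ltr_pM2r ?invr_gt0//.
case: ifP => _; last by rewrite mule0.
by rewrite -!EFinD -EFinM; congr EFin; field; rewrite gt_eqF.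
Qed.

Lemma scales_prod d1 d2 (T1 : measurableType d1) (T2 : measurableType d2)
  (m1 : {sigma_finite_measure set T1 -> \bar R}) (m2 : {sigma_finite_measure set T2 -> \bar R})
  phi1 phi2 (k1 k2 : R) : (0 <= k1)%R -> (0 <= k2)%R -> scales m1 phi1 k1 -> scales m2 phi2 k2 ->
  scales (m1 \x m2) (fun x => (phi1 x.1, phi2 x.2)) (k1 * k2).
Proof.
move=> k10 k20 [mphi1 s1] [mphi2 s2].
have mphi : measurable_fun setT (fun x : T1 * T2 => (phi1 x.1, phi2 x.2)).
  apply: measurable_fun_pair => /=.
    exact: measurableT_comp.
  exact: measurableT_comp.
split => // f mf f0.
rewrite fubini_tonelli1//= fubini_tonelli1//=; last exact: measurableT_comp.
rewrite /fubini_F /=.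
have mG : measurable_fun setT (fun x => \int[m2]_y f (x, phi2 y)).
  apply: (measurable_fun_fubini_tonelli_F (fun z : T1 * T2 => f (z.1, phi2 z.2))) => //.
  apply: measurableT_comp => //; apply: measurable_fun_pair => //=; exact: measurableT_comp.
under eq_integral => x _.
  rewrite s2//; last exact: measurableT_comp.
  over.
rewrite ge0_integralZl//=; last by move=> x _; exact: integral_ge0.
rewrite s1//; last by move=> x; exact: integral_ge0.
by rewrite muleA -EFinM mulrC.
Qed.

Lemma scales_leb3 (a : R) : (0 < a)%R ->
  scales (leb3 R) (fun x : R3 R => (a * x.1.1, a * x.1.2, a * x.2)%R) (a ^+ 3).
Proof.
move=> a0; have s1 := scales_lebesgue a0; have a0' := ltW a0.
have s2 := scales_prod a0' a0' s1 s1.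
have s3 := @scales_prod _ _ _ _ (sigma_finite_prod lebesgue_measure lebesgue_measure)
  _ _ _ _ _ (mulr_ge0 a0' a0') a0' s2 s1.
have -> : (a ^+ 3 = a * a * a)%R by rewrite !exprS expr0; ring.
exact: s3.
Qed.

Lemma swap_leb3 (f : R3 R -> R3 R -> \bar R) :
  measurable_fun setT (fun z : R3 R * R3 R => f z.1 z.2) ->
  (forall x y, 0 <= f x y) ->
  \int[leb3 R]_x \int[leb3 R]_y f x y = \int[leb3 R]_y \int[leb3 R]_x f x y.
Proof.
move=> mf f0.
exact: (@fubini_tonelli _ _ _ _ _ sigma_finite_leb3 sigma_finite_leb3 (fun z : R3 R * R3 R => f z.1 z.2)).
Qed.

Lemma measurable_int_leb3 d (T : measurableType d) (f : T -> R3 R -> \bar R) :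
  measurable_fun setT (fun z : T * R3 R => f z.1 z.2) ->
  (forall x y, 0 <= f x y) ->
  measurable_fun setT (fun x => \int[leb3 R]_y f x y).
Proof.
move=> mf f0.
exact: (@measurable_fun_fubini_tonelli_F _ _ _ _ _ sigma_finite_leb3 (fun z : T * R3 R => f z.1 z.2)).
Qed.

Lemma leb3_box (I1 I2 I3 : set (measurableTypeR R)) :
  measurable I1 -> measurable I2 -> measurable I3 ->
  leb3 R (I1 `*` I2 `*` I3) =
    lebesgue_measure I1 * lebesgue_measure I2 * lebesgue_measure I3.
Proof.
move=> m1 m2 m3.
have m12 := measurableX m1 m2.
apply: etrans (product_measure1E (lebesgue_measure \x lebesgue_measure) lebesgue_measure m12 m3) _.
by congr (_ * _); exact: product_measure1E.
Qed.

End Lebesgue3.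

(** * The Euclidean norm, balls and cubes *)

Section Euclid.
Context {R : realType}.
Implicit Types (x y : R3 R) (a r s t : R).

Lemma enorm_ge0 x : 0 <= enorm x. Proof. exact: sqrtr_ge0. Qed.

Lemma enorm_sqr x : enorm x ^+ 2 = x.1.1 ^+ 2 + x.1.2 ^+ 2 + x.2 ^+ 2.
Proof. by rewrite sqr_sqrtr// !addr_ge0// sqr_ge0. Qed.

Lemma edist_nonneg x y : 0 <= edist x y. Proof. exact: enorm_ge0. Qed.

Lemma edist_sqr x y :
  edist x y ^+ 2 = (x.1.1 - y.1.1) ^+ 2 + (x.1.2 - y.1.2) ^+ 2 + (x.2 - y.2) ^+ 2.
Proof. exact: enorm_sqr. Qed.

Lemma edistC x y : edist x y = edist y x.
Proof. by congr Num.sqrt; rewrite /=; ring. Qed.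

Lemma enormZ a x : 0 <= a -> enorm (a * x.1.1, a * x.1.2, a * x.2) = a * enorm x.
Proof.
move=> a0; apply: (@pexpIrn _ 2) => //; rewrite ?nnegrE ?mulr_ge0 ?enorm_ge0//.
by rewrite exprMn !enorm_sqr/=; ring.
Qed.

Lemma le_enorm2 x s : 0 <= s -> (enorm x <= s) = (enorm x ^+ 2 <= s ^+ 2).
Proof. by move=> s0; rewrite ler_pXn2r// nnegrE ?enorm_ge0. Qed.

Lemma lt_enorm2 x s : 0 <= s -> (enorm x < s) = (enorm x ^+ 2 < s ^+ 2).
Proof. by move=> s0; rewrite ltr_pXn2r// nnegrE ?enorm_ge0. Qed.

Lemma measurable_enorm : measurable_fun setT (@enorm R).
Proof.
have msqrt : measurable_fun setT (@Num.sqrt R).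
  by apply: nondecreasing_measurable => // u v; exact: ler_wsqrtr.
apply: (measurableT_comp msqrt).
apply: measurable_funD; first apply: measurable_funD.
- apply: measurable_funX; exact: (measurableT_comp measurable_fst).
- apply: measurable_funX; exact: (measurableT_comp measurable_snd).
- apply: measurable_funX; exact: measurable_snd.
Qed.

Lemma measurable_edist : measurable_fun setT (fun z : R3 R * R3 R => edist z.1 z.2).
Proof.
apply: (measurableT_comp measurable_enorm).
apply: measurable_fun_pair; first apply: measurable_fun_pair.
- apply: measurable_funB.
    exact: (measurableT_comp measurable_fst (measurableT_comp measurable_fst measurable_fst)).
  exact: (measurableT_comp measurable_fst (measurableT_comp measurable_fst measurable_snd)).
- apply: measurable_funB.
    exact: (measurableT_comp measurable_snd (measurableT_comp measurable_fst measurable_fst)).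
  exact: (measurableT_comp measurable_snd (measurableT_comp measurable_fst measurable_snd)).
- apply: measurable_funB.
    exact: (measurableT_comp measurable_snd measurable_fst).
  exact: (measurableT_comp measurable_snd measurable_snd).
Qed.

Lemma measurable_edist1 x : measurable_fun setT (fun y => edist x y).
Proof.
exact: (measurableT_comp measurable_edist (measurable_fun_pair (measurable_cst x) (@measurable_id _ _ setT))).
Qed.

Lemma measurable_inv_edist : measurable_fun setT (fun z : R3 R * R3 R => (edist z.1 z.2)^-1).
Proof.
(* both sides are 0 on the diagonal *)
have -> : (fun z : R3 R * R3 R => (edist z.1 z.2)^-1) = (fun z => edist z.1 z.2 `^ (-1)).
  by apply/funext => z; rewrite -powR_inv1// edist_nonneg.
exact: (measurableT_comp (measurable_powR (-1)) measurable_edist).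
Qed.

Lemma measurable_inv_edist1 x : measurable_fun setT (fun y => (edist x y)^-1).
Proof.
exact: (measurableT_comp measurable_inv_edist (measurable_fun_pair (measurable_cst x) (@measurable_id _ _ setT))).
Qed.

Lemma measurable_lt_set d (T : measurableType d) (f : T -> R) (r : R) :
  measurable_fun setT f -> measurable [set y | f y < r].
Proof.
move=> mf; rewrite [X in measurable X](_ : _ = ~` (setT `&` [set y | r <= f y])).
  by apply: measurableC; apply: measurable_fun_le.
by rewrite setTI; apply/seteqP; split => y /=; rewrite ltNge => /negP.
Qed.

Lemma measurable_le_set d (T : measurableType d) (f : T -> R) (r : R) :
  measurable_fun setT f -> measurable [set y | f y <= r].
Proof.
by move=> mf; rewrite -[X in measurable X]setTI; apply: measurable_fun_le.
Qed.

Definition eball x a : set (R3 R) := [set y | edist x y < a].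

Lemma measurable_eball x a : measurable (eball x a).
Proof. exact: measurable_lt_set (measurable_edist1 x). Qed.

Lemma leb3_cube (u v w s : R) : 0 <= s ->
  leb3 R (`]u, (u + s)%R[%classic `*` `]v, (v + s)%R[%classic `*` `]w, (w + s)%R[%classic) = (s ^+ 3)%:E.
Proof.
move=> s0; rewrite leb3_box//.
have E z : lebesgue_measure (`]z, (z + s)%R[%classic : set R) = s%:E.
  rewrite lebesgue_measure_itv/= lte_fin ltrDl; case: ltP => [_|s0'].
    by rewrite -EFinD addrAC subrr add0r.
  by congr EFin; apply/eqP; rewrite eq_le s0 s0'.
by rewrite !E -!EFinM; congr EFin; ring.
Qed.

(** The ball lies in the cube with the same center and side 2 a. *)
Lemma leb3_eball_le x a : 0 <= a -> (leb3 R (eball x a) <= (8 * a ^+ 3)%:E)%E.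
Proof.
move=> a0.
have -> : 8 * a ^+ 3 = (2 * a) ^+ 3 by ring.
rewrite -(leb3_cube (x.1.1 - a) (x.1.2 - a) (x.2 - a)) ?mulr_ge0//.
apply: le_measure; rewrite ?inE.
- exact: measurable_eball.
- by apply: measurableX => //; exact: measurableX.
move=> y; rewrite /eball/= /edist lt_enorm2// -/(edist x y) edist_sqr => xy.
have aux (u v w z : R) : (u - v) ^+ 2 + w ^+ 2 + z ^+ 2 < a ^+ 2 -> v \in `]u - a, u - a + 2 * a[.
  move=> h; rewrite in_itv/=.
  have : `|u - v| < a.
    rewrite -(@ltr_pXn2r _ 2)// ?nnegrE// real_normK ?num_real//.
    by apply: le_lt_trans h; rewrite -addrA lerDl addr_ge0// sqr_ge0.
  by rewrite ltr_norml => /andP[? ?]; apply/andP; split; lra.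
split => //=; first split => /=.
- by apply: aux xy.
- by apply: (aux _ _ (x.1.1 - y.1.1) (x.2 - y.2)); move: xy; lra.
- by apply: (aux _ _ (x.1.1 - y.1.1) (x.1.2 - y.1.2)); move: xy; lra.
Qed.

End Euclid.

(** * Newtonian potentials *)

Section Potential.
Context {R : realType}.
Implicit Types (x y : R3 R) (a r s t : R).
Local Open Scope ereal_scope.

Lemma measurable_indic_eball x a :
  measurable_fun setT (\1_(eball x a) : R3 R -> R).
Proof. apply: measurable_indic; exact: measurable_eball. Qed.

Lemma dyadic_shell (d a : R) : (0 < d -> d < a ->
  exists k : nat, d < a / 2 ^+ k /\ d^-1 <= 2 ^+ k.+1 / a)%R.
Proof.
move=> d0 da; have a0 := lt_trans d0 da.
have exk : exists k : nat, (a / 2 ^+ k.+1 <= d)%R.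
  have ad0 : (0 <= a / d)%R by rewrite divr_ge0// ltW.
  exists (Num.bound (a / d)).
  rewrite ler_pdivrMr ?exprn_gt0// mulrC -ler_pdivrMr//.
  apply: (le_trans (ltW (archi_boundP ad0))).
  rewrite -natrX ler_nat; apply: leq_trans (ltnW (ltn_expl _ (ltnSn 1))) _.
  by rewrite leq_exp2l.
case: (ex_minnP exk) => k kd kmin; exists k; split.
  case: k kd kmin => [|k] kd kmin; first by rewrite expr0 divr1.
  by rewrite ltNge; apply/negP => /kmin; rewrite ltnn.
rewrite -(invrK (2 ^+ k.+1 / a)%R) lef_pV2 ?posrE ?invr_gt0 ?divr_gt0 ?exprn_gt0//.
by rewrite invf_div.
Qed.

Lemma geo_sum4 n : (\sum_(0 <= k < n) (4^-1 : R) ^+ k <= 2 - 2 / 4 ^+ n)%R.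
Proof.
elim: n => [|n IH]; first by rewrite big_nil expr0; lra.
rewrite big_nat_recr//= (le_trans (lerD IH (lexx _)))//.
rewrite exprVn exprS invfM.
have : (0 <= (4 ^+ n)^-1 :> R)%R by rewrite invr_ge0 exprn_ge0.
lra.
Qed.

(** On the shell a / 2 ^ (k + 1) <= |x - y| < a / 2 ^ k the kernel is at most
2 ^ (k + 1) / a and the volume at most 8 (a / 2 ^ k) ^ 3, so that the shells contribute
16 a ^ 2 times a geometric series of ratio 1 / 4. *)
Lemma int_inv_edist_ball x a : (0 < a)%R ->
  \int[leb3 R]_(y in eball x a) ((edist x y)^-1)%:E <= (32 * a ^+ 2)%:E.
Proof.
move=> a0.
pose u k y := (2 ^+ k.+1 / a * \1_(eball x (a / 2 ^+ k)) y)%:E : \bar R.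
have u0 k y : 0 <= u k y.
  by rewrite lee_fin mulr_ge0// divr_ge0 ?exprn_ge0 // ltW.
have mu k : measurable_fun setT (u k).
  apply/measurable_EFinP; apply: measurable_funM => //.
  exact: measurable_indic_eball.
rewrite integral_mkcond.
apply: (@le_trans _ _ (\int[leb3 R]_y \sum_(k <oo) u k y)).
  apply: ge0_le_integral; rewrite ?measurableT//.
  - by move=> y _; apply: erestrict_ge0 => z _; rewrite lee_fin invr_ge0 edist_nonneg.
  - apply/(measurable_restrictT _ (measurable_eball x a)).
    apply: measurable_funTS; apply/measurable_EFinP; exact: measurable_inv_edist1.
  - exact: (@ge0_emeasurable_sum _ _ _ setT u xpredT).
  move=> y _; rewrite patchE; case: ifPn => [|_]; last exact: nneseries_ge0.
  rewrite inE /eball/= => da.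
  have [d0|d0] := eqVneq (edist x y) 0%R.
    by rewrite d0 invr0; exact: nneseries_ge0.
  have {}d0 : (0 < edist x y)%R by rewrite lt_neqAle eq_sym d0 edist_nonneg.
  have [k [dk kd]] := dyadic_shell d0 da.
  apply: le_trans (nneseries_lim_ge k.+1 _) => //.
  rewrite big_nat_recr//= (@le_trans _ _ (u k y))//.
    by rewrite /u indicE mem_set// mulr1 lee_fin.
  by apply: leeDr; apply: sume_ge0.
rewrite integral_nneseries//.
apply: lime_le; first by apply: is_cvg_nneseries => k _ _; exact: integral_ge0.
near=> n; rewrite (@le_trans _ _ (\sum_(0 <= k < n) (16 * a ^+ 2 * (4^-1) ^+ k)%:E))//.
  apply: lee_sum => k _; rewrite /u.
  under eq_integral do rewrite EFinM.
  rewrite ge0_integralZl_EFin//; last first.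
  - by rewrite divr_ge0 ?exprn_ge0// ltW.
  - by apply/measurable_EFinP; exact: measurable_indic_eball.
  rewrite integral_indic//; last exact: measurable_eball.
  rewrite setIT; apply: (@le_trans _ _ ((2 ^+ k.+1 / a)%:E * (8 * (a / 2 ^+ k) ^+ 3)%:E)).
    rewrite lee_wpmul2l ?lee_fin ?divr_ge0 ?exprn_ge0 ?(ltW a0)//.
    by apply: leb3_eball_le; rewrite divr_ge0 ?exprn_ge0 ?(ltW a0).
  rewrite -EFinM lee_fin (_ : (4^-1 = 2^-1 ^+ 2 :> R)%R); last by field.
  rewrite le_eqVlt; apply/orP; left; apply/eqP.
  rewrite -exprM mulnC exprM exprVn exprS.
  by field; rewrite !gt_eqF ?exprn_gt0.
rewrite sumEFin lee_fin -mulr_sumr.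
have := geo_sum4 n.
have : (0 <= (4 ^+ n)^-1 :> R)%R by rewrite invr_ge0 exprn_ge0.
have : (0 <= a ^+ 2)%R by rewrite exprn_ge0 ?ltW.
nra.
Unshelve. all: by end_near. Qed.

(** Near x the density is replaced by its bound t, and outside the ball of radius a
the kernel by 1 / a. *)
Lemma potential_le (rho : R3 R -> R) x a t :
  measurable_fun setT rho -> (forall y, 0 <= rho y)%R -> (0 < a)%R -> (0 <= t)%R ->
  {ae leb3 R, forall y, eball x a y -> (rho y <= t)%R} ->
  \int[leb3 R]_y (rho y / edist x y)%:E <=
  (32 * t * a ^+ 2)%:E + (a^-1)%:E * \int[leb3 R]_y (rho y)%:E.
Proof.
move=> mr r0 a0 t0 rt.
have d0 y : (0 <= (edist x y)^-1)%R by rewrite invr_ge0 edist_nonneg.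
have a0' : (0 <= a^-1)%R by rewrite invr_ge0 ltW.
have md := measurable_inv_edist1 x.
have mg : measurable_fun setT (fun y => (t * ((edist x y)^-1 * \1_(eball x a) y))%R).
  apply: measurable_funM => //; apply: measurable_funM => //.
  exact: measurable_indic_eball.
apply: (@le_trans _ _ (\int[leb3 R]_y ((t * ((edist x y)^-1 * \1_(eball x a) y))%:E + (a^-1 * rho y)%:E))).
  apply: ae_ge0_le_integral => //.
  - by move=> y _; rewrite lee_fin mulr_ge0.
  - by apply/measurable_EFinP/measurable_funM.
  - by move=> y _; rewrite -EFinD lee_fin addr_ge0// !mulr_ge0.
  - apply: emeasurable_funD.
      by have /measurable_EFinP := mg.
    by apply/measurable_EFinP; exact: measurable_funM.
  apply: filterS rt => y rt _; rewrite -EFinD lee_fin indicE.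
  have [/set_mem ya|/negP ya] := boolP (y \in eball x a).
    rewrite mulr1; rewrite ler_wpDr ?mulr_ge0// ler_wpM2r// rt//.
  rewrite !mulr0 add0r mulrC ler_wpM2r//.
  rewrite lef_pV2 ?posrE//.
    by rewrite leNgt; apply/negP => h; apply: ya; rewrite inE.
  by rewrite (lt_le_trans a0)// leNgt; apply/negP => h; apply: ya; rewrite inE.
rewrite ge0_integralD//; last first.
- by apply/measurable_EFinP/measurable_funM.
- by move=> y _; rewrite lee_fin mulr_ge0.
- exact/measurable_EFinP.
- by move=> y _; rewrite lee_fin !mulr_ge0.
apply: leeD; last first.
  under eq_integral do rewrite EFinM.
  rewrite ge0_integralZl_EFin//.
  - by move=> y _; rewrite lee_fin.
  - exact/measurable_EFinP.
under eq_integral do rewrite EFinM.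
rewrite ge0_integralZl_EFin//; last first.
- by apply/measurable_EFinP/measurable_funM => //; exact: measurable_indic_eball.
- by move=> y _; rewrite lee_fin mulr_ge0.
have -> : (32 * t * a ^+ 2 = t * (32 * a ^+ 2))%R by ring.
rewrite EFinM lee_wpmul2l ?lee_fin//.
apply: le_trans (int_inv_edist_ball x a0).
rewrite [leRHS]integral_mkcond le_eqVlt; apply/orP; left; apply/eqP.
apply: eq_integral => y _; rewrite patchE indicE; case: ifP => _.
  by rewrite mulr1.
by rewrite mulr0.
Qed.

End Potential.

(** * Moments of centered balls *)

Section Kinetic.
Context {R : realType}.
Implicit Types (x y p : R3 R) (a r s t : R).
Local Open Scope ereal_scope.

Definition oball a : set (R3 R) := [set p | (enorm p < a)%R].

Lemma measurable_oball a : measurable (oball a).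
Proof. exact: measurable_lt_set measurable_enorm. Qed.

Definition dilate a (p : R3 R) : R3 R := (a * p.1.1, a * p.1.2, a * p.2)%R.

Lemma int_oballZ (f : R3 R -> \bar R) a b : (0 < a)%R ->
  measurable_fun setT f -> (forall p, 0 <= f p) ->
  \int[leb3 R]_(p in oball (a * b)) f p =
  (a ^+ 3)%:E * \int[leb3 R]_(p in oball b) f (dilate a p).
Proof.
move=> a0 mf f0; have [mphi s3] := scales_leb3 a0.
rewrite integral_mkcond s3; last first.
- by move=> p; apply: erestrict_ge0.
- apply/(measurable_restrictT _ (measurable_oball _)).
  exact: measurable_funTS.
congr (_ * _); rewrite [RHS]integral_mkcond; apply: eq_integral => p _.
rewrite !patchE; congr (if _ then _ else _).
by apply/idP/idP; rewrite !inE /oball/= (enormZ _ (ltW a0)) ltr_pM2l.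
Qed.

Definition moment (k : nat) : R := fine (\int[leb3 R]_(p in oball 1) (enorm p ^+ k)%:E).

Lemma measurable_enormX k : measurable_fun setT (fun p : R3 R => (enorm p ^+ k)%:E).
Proof. by apply/measurable_EFinP; apply: measurable_funX; exact: measurable_enorm. Qed.

Lemma int_moment1 k : \int[leb3 R]_(p in oball 1) (enorm p ^+ k)%:E = (moment k)%:E.
Proof.
rewrite /moment fineK// ge0_fin_numE; last first.
  by apply: integral_ge0 => p _; rewrite lee_fin exprn_ge0 ?enorm_ge0.
apply: (@le_lt_trans _ _ (\int[leb3 R]_(p in oball 1) 1)).
  apply: ge0_le_integral => //.
  - exact: measurable_oball.
  - by move=> p _; rewrite lee_fin exprn_ge0 ?enorm_ge0.
  - by apply: measurable_funTS; exact: measurable_enormX.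
  - move=> p /ltW p1; rewrite lee_fin exprn_ile1 ?enorm_ge0//.
rewrite integral_cst; last exact: measurable_oball.
rewrite mul1e; have -> : oball 1 = eball (0, 0, 0)%R 1.
  apply/seteqP; split => p; rewrite /oball /eball/= edistC /edist/= !subr0; by case: p => -[].
by apply: le_lt_trans (leb3_eball_le _ _) _; rewrite ?ltry.
Qed.

Lemma int_moment k a : (0 <= a)%R ->
  \int[leb3 R]_(p in oball a) (enorm p ^+ k)%:E = (moment k * a ^+ (3 + k))%:E.
Proof.
rewrite le_eqVlt => /predU1P[<-|a0].
  rewrite exprD expr0n/= mul0r mulr0.
  rewrite (_ : oball 0 = set0) ?integral_set0//.
  by apply/seteqP; split => p //; rewrite /oball/= ltNge enorm_ge0.
rewrite -[X in oball X](mulr1 a) int_oballZ//; last first.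
- by move=> p; rewrite lee_fin exprn_ge0 ?enorm_ge0.
- exact: measurable_enormX.
under eq_integral do rewrite (enormZ _ (ltW a0)) exprMn EFinM.
rewrite ge0_integralZl_EFin//.
- by rewrite int_moment1 -!EFinM; congr EFin; rewrite exprD; ring.
- exact: measurable_oball.
- by move=> p _; rewrite lee_fin exprn_ge0 ?enorm_ge0.
- by apply: measurable_funTS; exact: measurable_enormX.
- by rewrite exprn_ge0 ?ltW.
Qed.

(** The unit ball contains a cube of side 1 / 4 on which the norm is at least 1 / 4. *)
Lemma moment_gt0 k : (0 < moment k)%R.
Proof.
rewrite -lte_fin -int_moment1.
pose Q : set (R3 R) := `](4^-1)%R, (4^-1 + 4^-1)%R[%classic `*` `](4^-1)%R, (4^-1 + 4^-1)%R[%classic `*` `](4^-1)%R, (4^-1 + 4^-1)%R[%classic.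
have mQ : measurable Q by apply: measurableX => //; exact: measurableX.
have q0 : (0 < 4^-1 :> R)%R by rewrite invr_gt0.
apply: (@lt_le_trans _ _ (\int[leb3 R]_(p in Q) (4^-1 ^+ k)%:E)).
  rewrite integral_cst// leb3_cube ?ltW// -EFinM lte_fin mulr_gt0//; exact: exprn_gt0.
apply: (@le_trans _ _ (\int[leb3 R]_(p in Q) (enorm p ^+ k)%:E)).
  apply: ge0_le_integral => //.
  - by apply: measurable_funTS; exact: measurable_enormX.
  - move=> p; rewrite /Q/= !in_itv/= => -[[/andP[p1 _] _] _].
    have p4 : (4^-1 <= enorm p)%R.
      rewrite leNgt lt_enorm2 ?ltW// enorm_sqr; apply/negP => h.
      have : (4^-1 ^+ 2 < p.1.1 ^+ 2)%R.
        by rewrite ltr_pXn2r// nnegrE ltW// (lt_trans q0).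
      by move: (sqr_ge0 p.1.2) (sqr_ge0 p.2); lra.
    by rewrite lee_fin lerXn2r// nnegrE ?enorm_ge0// ltW.
apply: ge0_subset_integral => //.
- exact: measurable_oball.
- by apply: measurable_funTS; exact: measurable_enormX.
- by move=> p _; rewrite lee_fin exprn_ge0 ?enorm_ge0.
move=> p; rewrite /Q/= !in_itv/= => -[[/andP[p1 p1'] /andP[p2 p2']] /andP[p3 p3']].
rewrite /oball/= lt_enorm2// enorm_sqr.
have aux (u : R) : (4^-1 < u -> u < 4^-1 + 4^-1 -> u ^+ 2 < 4^-1)%R by move=> ? ?; nra.
have := aux _ p1 p1'; have := aux _ p2 p2'; have := aux _ p3 p3'; lra.
Qed.

End Kinetic.

(** * Fermi densities of dispersion relations *)

Section Fermi.
Context {R : realType}.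
Implicit Types (x y p : R3 R) (a r s t q m L : R) (tau : R3 R -> R).

Definition fermi_momentum q s : R := (6 * pi ^+ 2 * s / q) `^ (1 / 3).

Definition dispersion m tau : Prop :=
  [/\ measurable_fun setT tau, forall p, 0 <= tau p,
      forall a p, 1 <= a -> tau (dilate a p) <= a ^+ 2 * tau p
    & forall p, tau p <= enorm p ^+ 2 / (2 * m)].

(** A lower bound by a line of slope L, in the form that |p| ^ 2 / (2 m) satisfies for
every L and the relativistic relation for L < c. *)
Definition steep m L tau : Prop := forall p, L * enorm p - m * L ^+ 2 <= tau p.

Lemma fermi_const_gt0 q : 0 < q -> 0 < 6 * pi ^+ 2 / q :> R.
Proof. by move=> q0; rewrite divr_gt0// mulr_gt0// exprn_gt0// pi_gt0. Qed.

Lemma fermi_momentum_ge0 q s : 0 <= fermi_momentum q s.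
Proof. exact: powR_ge0. Qed.

Lemma fermi_momentum0 q : fermi_momentum q 0 = 0.
Proof. by rewrite /fermi_momentum mulr0 mul0r powR0// mulf_neq0. Qed.

Lemma fermi_momentumX q s n : 0 <= s -> 0 < q ->
  fermi_momentum q s ^+ n = (6 * pi ^+ 2 / q) `^ (n%:R / 3) * s `^ (n%:R / 3).
Proof.
move=> s0 q0; rewrite /fermi_momentum -powR_mulrn ?powR_ge0// -powRrM.
have -> : 6 * pi ^+ 2 * s / q = (6 * pi ^+ 2 / q) * s by field; rewrite gt_eqF.
have P0 := ltW (fermi_const_gt0 q0).
rewrite powRM//; congr (_ `^ _ * _ `^ _); by field.
Qed.

Lemma fermi_momentum3 q s : 0 <= s -> 0 < q ->
  fermi_momentum q s ^+ 3 = 6 * pi ^+ 2 / q * s.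
Proof.
move=> s0 q0; rewrite fermi_momentumX// divff// !powRr1//.
exact: ltW (fermi_const_gt0 q0).
Qed.

Lemma fermi_momentum_le q s t : 0 < q -> 0 <= s -> s <= t ->
  fermi_momentum q s <= fermi_momentum q t.
Proof.
move=> q0 s0 st; have C0 := ltW (fermi_const_gt0 q0).
rewrite /fermi_momentum (mulrAC _ s) (mulrAC _ t).
have t0 := le_trans s0 st.
apply: ge0_ler_powR; rewrite ?nnegrE ?(mulr_ge0 C0 s0) ?(mulr_ge0 C0 t0) ?ler_wpM2l//.
Qed.

Lemma fermi_momentumZ q s b : 0 < q -> 0 <= b -> 0 <= s ->
  fermi_momentum q (b * s) = b `^ (1 / 3) * fermi_momentum q s.
Proof.
move=> q0 b0 s0; have C0 := ltW (fermi_const_gt0 q0).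
rewrite /fermi_momentum (mulrAC _ s) (mulrAC _ (b * s)) -powRM ?(mulr_ge0 C0 s0)//.
by congr powR; ring.
Qed.

Section Density.
Variables (q m : R) (tau : R3 R -> R).
Hypotheses (q0 : 0 < q) (m0 : 0 < m) (tauP : dispersion m tau).

Let j := fermi_density q tau.
Let cq : R := q / (8 * pi ^+ 3).
Let F a : \bar R := (\int[leb3 R]_(p in oball a) (tau p)%:E)%E.

Let cq0 : 0 < cq.
Proof. by rewrite divr_gt0 ?mulr_gt0 ?exprn_gt0 ?pi_gt0. Qed.

Let jE s : j s = (cq%:E * F (fermi_momentum q s))%E.
Proof. by []. Qed.

Let mtau D : measurable_fun D (fun p => (tau p)%:E).
Proof. by case: tauP => ? _ _ _; apply/measurable_EFinP; exact: measurable_funTS. Qed.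

Let tau0 p : 0 <= tau p.
Proof. by case: tauP. Qed.

Let F_ge0 a : (0 <= F a)%E.
Proof. by apply: integral_ge0 => p _; rewrite lee_fin. Qed.

Lemma fermi_density_ge0 s : (0 <= j s)%E.
Proof. by rewrite jE mule_ge0// lee_fin ltW. Qed.

Lemma fermi_density0 : j 0 = 0%E.
Proof.
rewrite jE fermi_momentum0 /F (_ : oball 0 = set0) ?integral_set0 ?mule0//.
by apply/seteqP; split => p //; rewrite /oball/= ltNge enorm_ge0.
Qed.

(** The Fermi ball grows by the factor c = b ^ (1/3).  Rescaling it costs c ^ 3 for the
volume and c ^ 2 for tau, and c ^ 5 <= c ^ 6 = b ^ 2.  The exponent 2 is the one with
which the Coulomb energy scales. *)
Lemma fermi_densityZ b s : 1 <= b -> 0 <= s -> (j (b * s) <= (b ^+ 2)%:E * j s)%E.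
Proof.
move=> b1 s0; have b0 : 0 <= b := le_trans ler01 b1.
rewrite !jE fermi_momentumZ//; set c := b `^ (1 / 3).
have c1 : 1 <= c.
  have <- : 1 `^ (1 / 3) = 1 :> R by rewrite powR1.
  by apply: ge0_ler_powR; rewrite ?nnegrE ?divr_ge0.
have c0 : 0 < c := lt_le_trans ltr01 c1.
have bE : b = c ^+ 3.
  rewrite /c -powR_mulrn ?powR_ge0// -powRrM (_ : 1 / 3 * 3%:R = 1) ?powRr1//.
  by field.
rewrite muleCA; apply: lee_wpmul2l; first by rewrite lee_fin ltW.
rewrite /F int_oballZ//.
apply: (@le_trans _ _ ((c ^+ 3)%:E * ((c ^+ 2)%:E * F (fermi_momentum q s)))%E).
  apply: lee_wpmul2l; first by rewrite lee_fin exprn_ge0// ltW.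
  rewrite -ge0_integralZl_EFin//.
  - apply: ge0_le_integral => //.
    + exact: measurable_oball.
    + by move=> p _; rewrite lee_fin.
    + case: tauP => mt _ _ _; have [mphi _] := scales_leb3 c0.
      apply/measurable_EFinP; apply: measurable_funTS.
      exact: (measurableT_comp mt mphi).
    + under eq_fun do rewrite -EFinM.
      apply/measurable_EFinP; apply: measurable_funM => //; exact/measurable_EFinP.
    + by move=> p _; rewrite -EFinM lee_fin; case: tauP => _ _ + _; apply.
  - exact: measurable_oball.
  - by move=> p _; rewrite lee_fin.
  - by rewrite exprn_ge0// ltW.
rewrite muleA; apply: lee_wpmul2r => //.
rewrite -EFinM lee_fin bE -!exprD -exprM ler_weXn2l//.
Qed.

Lemma fermi_density_le s : 0 <= s ->
  (j s <= (cq / (2 * m) * moment 2 * (6 * pi ^+ 2 / q) `^ (5 / 3) * s `^ (5 / 3))%:E)%E.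
Proof.
move=> s0; rewrite jE.
apply: (@le_trans _ _ (cq%:E * ((2 * m)^-1%:E * (moment 2 * fermi_momentum q s ^+ (3 + 2))%:E))%E).
  apply: lee_wpmul2l; first by rewrite lee_fin ltW.
  rewrite -int_moment ?fermi_momentum_ge0// -ge0_integralZl_EFin//.
  - apply: ge0_le_integral => //.
    + exact: measurable_oball.
    + by move=> p _; rewrite lee_fin.
    + under eq_fun do rewrite -EFinM.
      apply/measurable_EFinP; apply: measurable_funM => //.
      apply/measurable_EFinP; apply: measurable_funTS; exact: measurable_enormX.
    + by move=> p _; rewrite -EFinM lee_fin; case: tauP => _ _ _; rewrite [leRHS]mulrC; apply.
  - exact: measurable_oball.
  - by move=> p _; rewrite lee_fin exprn_ge0 ?enorm_ge0.
  - apply: measurable_funTS; exact: measurable_enormX.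
  - by rewrite invr_ge0 mulr_ge0 ?ltW.
by rewrite -!EFinM lee_fin fermi_momentumX// !mulrA.
Qed.

Lemma fermi_density_fin s : 0 <= s -> j s \is a fin_num.
Proof.
move=> s0; rewrite ge0_fin_numE ?fermi_density_ge0//.
by apply: le_lt_trans (fermi_density_le s0) _; rewrite ltry.
Qed.

(** The integral over the Fermi ball of the nonnegative function
tau + m L ^ 2 - L |p| increases with the ball; the integrals of m L ^ 2 and of L |p|
are multiples of s and of s ^ (4/3). *)
Lemma fermi_density_incr L s t : 0 < L -> steep m L tau -> 0 <= t -> t <= s ->
  (j t + (L * (cq * moment 1 * (6 * pi ^+ 2 / q) `^ (4 / 3)) * (s `^ (4 / 3) - t `^ (4 / 3)))%:E <=
   j s + (m * L ^+ 2 * (cq * moment 0 * (6 * pi ^+ 2 / q)) * (s - t))%:E)%E.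
Proof.
move=> L0 st t0 ts; have s0 := le_trans t0 ts.
pose sg p := tau p + m * L ^+ 2 * enorm p ^+ 0 - L * enorm p ^+ 1.
have sg0 p : 0 <= sg p by have := st p; rewrite /sg expr0 expr1; lra.
have msg D : measurable_fun D (fun p => (sg p)%:E).
  apply/measurable_EFinP; apply: measurable_funB; first apply: measurable_funD.
  - exact/measurable_EFinP.
  - by apply: measurable_funM => //; apply/measurable_EFinP/measurable_funTS; exact: measurable_enormX.
  - by apply: measurable_funM => //; apply/measurable_EFinP/measurable_funTS; exact: measurable_enormX.
have mL : 0 <= m * L ^+ 2 by rewrite mulr_ge0 ?sqr_ge0 ?ltW.
have key a : 0 <= a ->
    (F a + (m * L ^+ 2 * (moment 0 * a ^+ 3))%:E =
     \int[leb3 R]_(p in oball a) (sg p)%:E + (L * (moment 1 * a ^+ 4))%:E)%E.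
  move=> a0; have mB := @measurable_oball R a.
  have men k : measurable_fun (oball a) (fun p : R3 R => (enorm p ^+ k)%:E).
    by apply: measurable_funTS; exact: measurable_enormX.
  have menr k : measurable_fun (oball a) (fun p : R3 R => enorm p ^+ k).
    by apply/measurable_EFinP; exact: men.
  have en0 k p : (0 <= (enorm p ^+ k)%:E :> \bar R)%E by rewrite lee_fin exprn_ge0 ?enorm_ge0.
  rewrite [X in (_ + X = _)%E]EFinM [X in (_ = _ + X)%E]EFinM.
  rewrite -(int_moment 0 a0) -(int_moment 1 a0).
  rewrite -!ge0_integralZl_EFin// ?(ltW L0)//.
  rewrite -!ge0_integralD//; last first.
  - by under eq_fun do rewrite -EFinM; apply/measurable_EFinP; apply: measurable_funM => //; exact: menr.
  - by move=> p _; rewrite -EFinM lee_fin mulr_ge0 ?(ltW L0)// exprn_ge0 ?enorm_ge0.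
  - by move=> p _; rewrite lee_fin.
  - by under eq_fun do rewrite -EFinM; apply/measurable_EFinP; apply: measurable_funM => //; exact: menr.
  - by move=> p _; rewrite -EFinM lee_fin mulr_ge0 ?(ltW L0)// exprn_ge0 ?enorm_ge0.
  - by move=> p _; rewrite lee_fin.
  by apply: eq_integral => p _; rewrite -!EFinM -!EFinD; congr EFin; rewrite /sg; ring.
have Fmon : (\int[leb3 R]_(p in oball (fermi_momentum q t)) (sg p)%:E <=
             \int[leb3 R]_(p in oball (fermi_momentum q s)) (sg p)%:E)%E.
  apply: ge0_subset_integral => //; try exact: measurable_oball.
  - by move=> p _; rewrite lee_fin.
  - by move=> p; rewrite /oball/= => /lt_le_trans; apply; exact: fermi_momentum_le.
have solveI (I : \bar R) u v : (u%:E = I + v%:E)%E -> I = (u - v)%:E.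
  by move=> h; rewrite EFinB h addeK.
have fF u : 0 <= u -> exists2 v, F (fermi_momentum q u) = v%:E & j u = (cq * v)%:E.
  move=> u0; have /fineK ju := fermi_density_fin u0.
  exists (fine (j u) / cq); last by rewrite mulrC divfK ?gt_eqF// ju.
  move: ju; rewrite jE; case: (F _) => [v| |].
  - by rewrite -EFinM/= mulrC mulfK ?gt_eqF.
  - by rewrite gt0_muley ?lte_fin.
  - by rewrite gt0_muleNy ?lte_fin.
have [vt Ft jt] := fF t t0; have [vs Fs js] := fF s s0.
have := key _ (fermi_momentum_ge0 q t); have := key _ (fermi_momentum_ge0 q s).
rewrite Ft Fs -!EFinD => /solveI ks /solveI kt.
move: Fmon; rewrite jt js ks kt -!EFinD !lee_fin !fermi_momentum3// !fermi_momentumX//.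
by move/(ler_wpM2l (ltW cq0)); lra.
Qed.

Lemma fermi_density_mono s t : 0 <= s -> s <= t -> (j s <= j t)%E.
Proof.
move=> s0 st; rewrite !jE; apply: lee_wpmul2l; first by rewrite lee_fin ltW.
apply: ge0_subset_integral => //; try exact: measurable_oball.
- by move=> p _; rewrite lee_fin.
- by move=> p; rewrite /oball/= => /lt_le_trans; apply; exact: fermi_momentum_le.
Qed.

(** The Fermi ball enters through a measurable subset of the product of position and
momentum space. *)
Lemma measurable_fermi_density (rho : R3 R -> R) :
  measurable_fun setT rho -> measurable_fun setT (fun x => j (rho x)).
Proof.
move=> mr.
pose A : set (R3 R * R3 R) :=
  [set z | enorm z.2 - fermi_momentum q (rho z.1) < 0].
have mA : measurable A.
  apply: measurable_lt_set; apply: measurable_funB.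
    exact: (measurableT_comp measurable_enorm measurable_snd).
  apply: (measurableT_comp (measurable_powR (1 / 3))).
  apply: measurable_funM => //; apply: measurable_funM => //.
  exact: (measurableT_comp mr measurable_fst).
have -> : (fun x => j (rho x)) = (fun x => cq%:E * \int[leb3 R]_p (tau p * \1_A (x, p))%:E)%E.
  apply/funext => x; rewrite jE /F integral_mkcond; congr (_ * _)%E.
  apply: eq_integral => p _; rewrite patchE indicE.
  have -> : ((x, p) \in A) = (p \in oball (fermi_momentum q (rho x))).
    by apply/idP/idP; rewrite !inE /A /oball/= subr_lt0.
  by case: ifP => _; rewrite ?mulr1 ?mulr0.
apply: emeasurable_funM; first exact: measurable_cst.
apply: measurable_int_leb3 => /=.
  apply/measurable_EFinP; apply: measurable_funM.
    by case: tauP => mt _ _ _; exact: (measurableT_comp mt measurable_snd).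
  have -> : (fun z : R3 R * R3 R => \1_A (z.1, z.2) : R) = \1_A.
    by apply/funext => -[].
  exact: measurable_indic.
by move=> x p; rewrite lee_fin mulr_ge0.
Qed.

End Density.
End Fermi.

(** * Admissible densities and the Coulomb energy *)

Section Densities.
Context {R : realType}.
Implicit Types (x y : R3 R) (r s t p : R) (rho f g h : R3 R -> R).
Local Open Scope ereal_scope.

Lemma LfunE p rho : (0 < p)%R -> (forall x, 0 <= rho x)%R ->
  (rho \in Lfun (leb3 R) p%:E) <->
  measurable_fun setT rho /\ \int[leb3 R]_x (rho x `^ p)%:E < +oo.
Proof.
move=> p0 r0.
have fE : (finite_norm (leb3 R) p%:E rho : Prop) <-> \int[leb3 R]_x (rho x `^ p)%:E < +oo.
  rewrite /finite_norm unlock /Lnorm.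
  have -> : \int[leb3 R]_x `|(EFin \o rho) x| `^ p = \int[leb3 R]_x (rho x `^ p)%:E.
    by apply: eq_integral => x _; rewrite /= ger0_norm.
  split; last exact: poweR_lty.
  by apply: lty_poweRy; rewrite gt_eqF// invr_gt0.
split=> [/andP[]|[mr fr]].
  by rewrite !inE /= => mr /fE.
by apply/andP; split; rewrite inE/=; [exact: mr|exact/fE].
Qed.

Lemma Lfun1E rho : (forall x, 0 <= rho x)%R ->
  (rho \in Lfun (leb3 R) 1%E) <->
  measurable_fun setT rho /\ \int[leb3 R]_x (rho x)%:E < +oo.
Proof.
move=> r0; rewrite LfunE//; split=> -[mr].
  by under eq_integral do rewrite powRr1//.
by move=> h; split => //; under eq_integral do rewrite powRr1//.
Qed.

Lemma densityP p rho : (0 < p)%R -> density p rho <->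
  [/\ forall x, (0 <= rho x)%R, measurable_fun setT rho,
      \int[leb3 R]_x (rho x)%:E < +oo & \int[leb3 R]_x (rho x `^ p)%:E < +oo].
Proof.
move=> p0; split=> [[r0 /Lfun1E[]// mr r1 /LfunE[]//]|[r0 mr r1 rp]].
by split=> //; [apply/Lfun1E|apply/LfunE].
Qed.

Lemma density_scaled_part p b rho rho1 : (0 < p)%R -> (0 <= b)%R -> density p rho ->
  measurable_fun setT rho1 -> (forall x, 0 <= rho1 x <= rho x)%R ->
  density p (fun x => b * rho1 x)%R.
Proof.
move=> p0 b0 /(densityP _ p0)[r0 mr r1 rp] mr1 h.
have h0 x : (0 <= rho1 x)%R by case/andP: (h x).
have h1 x : (rho1 x <= rho x)%R by case/andP: (h x).
apply/(densityP _ p0); split.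
- by move=> x; rewrite mulr_ge0.
- exact: measurable_funM.
- under eq_integral do rewrite EFinM.
  rewrite ge0_integralZl_EFin//; last first.
  + exact/measurable_EFinP.
  + by move=> x _; rewrite lee_fin.
  apply: lte_mul_pinfty; [by rewrite lee_fin|by []|apply: le_lt_trans r1].
  by apply: ge0_le_integral => //; [move=> x _; rewrite lee_fin|exact/measurable_EFinP|
    exact/measurable_EFinP|move=> x _; rewrite lee_fin].
have mpow f : measurable_fun setT f -> measurable_fun setT (fun x : R3 R => (f x `^ p)%:E).
  by move=> mf; apply/measurable_EFinP; exact: (measurableT_comp (measurable_powR p) mf).
under eq_integral do rewrite powRM// EFinM.
rewrite ge0_integralZl_EFin ?powR_ge0//; last first.
- exact: mpow.
- by move=> x _; rewrite lee_fin powR_ge0.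
apply: lte_mul_pinfty; [by rewrite lee_fin powR_ge0|by []|apply: le_lt_trans rp].
apply: ge0_le_integral => //.
- by move=> x _; rewrite lee_fin powR_ge0.
- exact: mpow.
- exact: mpow.
- by move=> x _; rewrite lee_fin; apply: ge0_ler_powR; rewrite ?nnegrE ?(ltW p0).
Qed.

(** s ^ p <= s + s ^ q, by comparing s with 1. *)
Lemma density_lower_exponent p q rho : (1 <= p)%R -> (p <= q)%R -> density q rho -> density p rho.
Proof.
move=> p1 pq; have p0 := lt_le_trans ltr01 p1; have q0 := lt_le_trans p0 pq.
move=> /(densityP _ q0)[r0 mr r1 rq]; apply/(densityP _ p0); split; [by []|by []|exact: r1|].
have mpow u : measurable_fun setT (fun x : R3 R => (rho x `^ u)%:E).
  by apply/measurable_EFinP; exact: (measurableT_comp (measurable_powR u) mr).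
apply: (@le_lt_trans _ _ (\int[leb3 R]_x ((rho x)%:E + (rho x `^ q)%:E))).
  apply: ge0_le_integral => //.
  - by move=> x _; rewrite lee_fin powR_ge0.
  - by apply: emeasurable_funD => //; exact/measurable_EFinP.
  move=> x _; rewrite -EFinD lee_fin.
  have [rx1|rx1] := leP (rho x) 1%R.
    rewrite ler_wpDr ?powR_ge0//.
    have [->|rx0] := eqVneq (rho x) 0%R; first by rewrite powR0// gt_eqF.
    rewrite -[leRHS](powRr1 (r0 x)); apply: ger_powR => //.
    by rewrite rx1 lt_neqAle eq_sym rx0 r0.
  by rewrite ler_wpDl// ler_powR// ltW.
rewrite ge0_integralD; [exact: lte_add_pinfty|by []|by move=> x _; rewrite lee_fin| | |exact: mpow].
- exact/measurable_EFinP.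
- by move=> x _; rewrite lee_fin powR_ge0.
Qed.

Definition potential rho x : \bar R := \int[leb3 R]_y (rho y / edist x y)%:E.

(** Bilinear form of twice the Coulomb energy. *)
Definition mutual (f g : R3 R -> R) : \bar R :=
  \int[leb3 R]_x \int[leb3 R]_y (f x * g y / edist x y)%:E.

Section Mutual.
Variables f g : R3 R -> R.
Hypotheses (f0 : forall x, (0 <= f x)%R) (g0 : forall x, (0 <= g x)%R).
Hypotheses (mf : measurable_fun setT f) (mg : measurable_fun setT g).

Let k0 x y : (0 <= f x * g y / edist x y)%R.
Proof. by rewrite !mulr_ge0// invr_ge0 edist_nonneg. Qed.

Lemma measurable_mutual_kernel :
  measurable_fun setT (fun z : R3 R * R3 R => (f z.1 * g z.2 / edist z.1 z.2)%:E).
Proof.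
apply/measurable_EFinP; apply: measurable_funM; last exact: measurable_inv_edist.
by apply: measurable_funM; [exact: measurableT_comp mf _|exact: measurableT_comp mg _].
Qed.

Lemma potential_ge0 x : 0 <= potential g x.
Proof. by apply: integral_ge0 => y _; rewrite lee_fin mulr_ge0// invr_ge0 edist_nonneg. Qed.

Lemma measurable_potential : measurable_fun setT (potential g).
Proof.
apply: (measurable_int_leb3 (f := fun x y => (g y / edist x y)%:E)) => /=.
  apply/measurable_EFinP; apply: measurable_funM; last exact: measurable_inv_edist.
  exact: measurableT_comp mg _.
by move=> x y; rewrite lee_fin mulr_ge0// invr_ge0 edist_nonneg.
Qed.

Lemma mutual_ge0 : 0 <= mutual f g.
Proof. by apply: integral_ge0 => x _; apply: integral_ge0 => y _; rewrite lee_fin. Qed.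

Lemma mutualE : mutual f g = \int[leb3 R]_x ((f x)%:E * potential g x).
Proof.
apply: eq_integral => x _; rewrite /potential -ge0_integralZl_EFin//.
- by apply: eq_integral => y _; rewrite -EFinM mulrA.
- by move=> y _; rewrite lee_fin mulr_ge0// invr_ge0 edist_nonneg.
- apply/measurable_EFinP; apply: measurable_funM => //; exact: measurable_inv_edist1.
Qed.

(** The bound is asked only where f charges, so that it can exploit the decay of the
potential when f lives far out. *)
Lemma mutual_le_mass c : (0 <= c)%R -> (forall x, f x != 0%R -> potential g x <= c%:E) ->
  mutual f g <= c%:E * \int[leb3 R]_x (f x)%:E.
Proof.
move=> c0 fc; rewrite mutualE -ge0_integralZl_EFin//; last first.
- exact/measurable_EFinP.
- by move=> x _; rewrite lee_fin.
apply: ge0_le_integral => //.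
- by move=> x _; rewrite mule_ge0 ?lee_fin ?potential_ge0.
- by apply: emeasurable_funM; [exact/measurable_EFinP|exact: measurable_potential].
- by apply: emeasurable_funM => //; exact/measurable_EFinP.
move=> x _; have [->|fx] := eqVneq (f x) 0%R; first by rewrite mul0e mule0.
by rewrite muleC lee_wpmul2r ?lee_fin// fc.
Qed.

End Mutual.

Lemma mutualC f g : (forall x, 0 <= f x)%R -> (forall x, 0 <= g x)%R ->
  measurable_fun setT f -> measurable_fun setT g -> mutual f g = mutual g f.
Proof.
move=> f0 g0 mf mg.
have k0 x y : 0 <= (f x * g y / edist x y)%:E.
  by rewrite lee_fin !mulr_ge0// invr_ge0 edist_nonneg.
apply: (etrans (swap_leb3 (f := fun x y => (f x * g y / edist x y)%:E)
  (measurable_mutual_kernel mf mg) k0)).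
apply: eq_integral => x _; apply: eq_integral => y _.
by rewrite edistC (mulrC (f y)).
Qed.

Lemma mutualDl f g h : (forall x, 0 <= f x)%R -> (forall x, 0 <= g x)%R ->
  (forall x, 0 <= h x)%R ->
  measurable_fun setT f -> measurable_fun setT g -> measurable_fun setT h ->
  mutual (fun x => f x + g x)%R h = mutual f h + mutual g h.
Proof.
move=> f0 g0 h0 mf mg mh.
have mfg : measurable_fun setT (fun x => f x + g x)%R by exact: measurable_funD.
have fg0 x : (0 <= f x + g x)%R by rewrite addr_ge0.
rewrite (mutualE fg0)// (mutualE f0)// (mutualE g0)//.
have me (u : R3 R -> R) : measurable_fun setT u -> measurable_fun setT (fun x : R3 R => (u x)%:E * potential h x).
  by move=> mu; apply: emeasurable_funM; [exact/measurable_EFinP|exact: measurable_potential].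
rewrite -ge0_integralD//; try exact: me.
- by apply: eq_integral => x _; rewrite EFinD ge0_muleDl ?lee_fin.
- by move=> x _; rewrite mule_ge0 ?lee_fin ?potential_ge0.
- by move=> x _; rewrite mule_ge0 ?lee_fin ?potential_ge0.
Qed.

Lemma mutualZ a f g : (0 <= a)%R -> (forall x, 0 <= f x)%R -> (forall x, 0 <= g x)%R ->
  measurable_fun setT f -> measurable_fun setT g ->
  mutual (fun x => a * f x)%R g = a%:E * mutual f g.
Proof.
move=> a0 f0 g0 mf mg.
have maf : measurable_fun setT (fun x => a * f x)%R by exact: measurable_funM.
have af0 x : (0 <= a * f x)%R by rewrite mulr_ge0.
rewrite (mutualE af0)// (mutualE f0)//.
rewrite -ge0_integralZl_EFin//.
- by apply: eq_integral => x _; rewrite EFinM muleA.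
- by move=> x _; rewrite mule_ge0 ?lee_fin ?potential_ge0.
- by apply: emeasurable_funM; [exact/measurable_EFinP|exact: measurable_potential].
Qed.

Lemma coulombE f : coulomb f = (1 / 2)%:E * mutual f f.
Proof. by []. Qed.

Lemma coulomb_ge0 f : (forall x, 0 <= f x)%R -> 0 <= coulomb f.
Proof. by move=> f0; rewrite coulombE mule_ge0 ?mutual_ge0// lee_fin divr_ge0. Qed.

Lemma coulombZ a f : (0 <= a)%R -> (forall x, 0 <= f x)%R -> measurable_fun setT f ->
  coulomb (fun x => a * f x)%R = (a ^+ 2)%:E * coulomb f.
Proof.
move=> a0 f0 mf; rewrite !coulombE.
have maf : measurable_fun setT (fun x => a * f x)%R by exact: measurable_funM.
have af0 x : (0 <= a * f x)%R by rewrite mulr_ge0.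
have -> := etrans (mutualZ a0 f0 af0 mf maf)
  (congr1 (mule a%:E) (etrans (mutualC f0 af0 mf maf) (mutualZ a0 f0 f0 mf mf))).
by rewrite muleCA (muleCA (1 / 2)%:E) muleA -EFinM -expr2 muleCA.
Qed.

Lemma coulombD f g : (forall x, 0 <= f x)%R -> (forall x, 0 <= g x)%R ->
  measurable_fun setT f -> measurable_fun setT g ->
  coulomb (fun x => f x + g x)%R = coulomb f + coulomb g + mutual g f.
Proof.
move=> f0 g0 mf mg; rewrite !coulombE.
have mfg : measurable_fun setT (fun x => f x + g x)%R by exact: measurable_funD.
have fg0 x : (0 <= f x + g x)%R by rewrite addr_ge0.
have -> := mutualDl f0 g0 fg0 mf mg mfg.
have -> := etrans (mutualC f0 fg0 mf mfg) (mutualDl f0 g0 f0 mf mg mf).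
have -> := etrans (mutualC g0 fg0 mg mfg) (mutualDl f0 g0 g0 mf mg mg).
have -> := mutualC f0 g0 mf mg.
have ff := mutual_ge0 f0 f0; have gg := mutual_ge0 g0 g0; have gf := mutual_ge0 g0 f0.
move: (mutual f f) (mutual g g) (mutual g f) ff gg gf => A B C A0 B0 C0.
rewrite !ge0_muleDr ?adde_ge0// (addeC ((1 / 2)%:E * C)) addeACA; congr (_ + _).
rewrite -ge0_muleDl ?lee_fin ?divr_ge0// -EFinD.
by rewrite (_ : 1 / 2 + 1 / 2 = 1)%R ?mul1e//; field.
Qed.

End Densities.

(** * The Coulomb bound and uniform densities on cubes *)

Section Bounds.
Context {R : realType}.
Implicit Types (x y : R3 R) (f g h rho : R3 R -> R).
Local Open Scope ereal_scope.

Lemma ge0_lty_real (x : \bar R) : 0 <= x -> x < +oo -> exists2 r : R, (0 <= r)%R & x = r%:E.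
Proof. by case: x => [r| |]//; rewrite lee_fin => r0 _; exists r. Qed.

(** [potential_le] at the radius n / u, where both of its terms are multiples of
u n ^ 2. *)
Lemma potential_bound (n u : R) rho x : (0 < n)%R -> (0 < u)%R ->
  measurable_fun setT rho -> (forall y, 0 <= rho y)%R ->
  \int[leb3 R]_y (rho y)%:E <= (n ^+ 3)%:E ->
  {ae leb3 R, forall y, (rho y <= u ^+ 3)%R} ->
  potential rho x <= (33 * u * n ^+ 2)%:E.
Proof.
move=> n0 u0 mr r0 rn ru.
have nu0 : (0 < n / u)%R by rewrite divr_gt0.
have ru' : {ae leb3 R, forall y, eball x (n / u)%R y -> (rho y <= u ^+ 3)%R}.
  by apply: filterS ru => y + _.
rewrite /potential; apply: (le_trans (potential_le mr r0 nu0 (exprn_ge0 3 (ltW u0)) ru')).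
apply: (@le_trans _ _ ((32 * u ^+ 3 * (n / u) ^+ 2)%:E + ((n / u)^-1)%:E * (n ^+ 3)%:E)).
  by apply: leeD => //; apply: lee_wpmul2l => //; rewrite lee_fin invr_ge0 ltW.
rewrite -EFinM -EFinD lee_fin le_eqVlt; apply/orP; left; apply/eqP.
by field; rewrite !gt_eqF.
Qed.

(** The form in which the bound is applied to the excess of a density above a height,
where M is at most the total mass and H is paid for by kinetic energy. *)
Lemma coulomb_bound_real kappa q Nstar h (M H : R) : (0 < kappa)%R -> (0 < Nstar)%R ->
  coulomb_bound kappa q Nstar -> density (4 / 3) h ->
  \int[leb3 R]_x (h x)%:E = M%:E -> \int[leb3 R]_x (h x `^ (4 / 3))%:E = H%:E ->
  kappa%:E * coulomb h <= (K_cl q / Nstar `^ (2 / 3) * H * M `^ (2 / 3))%:E.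
Proof.
move=> k0 N0 cb dh hM hH; have h0 : forall x, (0 <= h x)%R by case: dh.
have nN : (0 < Nstar `^ (2 / 3))%R by rewrite powR_gt0.
have := cb _ dh; rewrite Lnorm1 poweR_Lnorm; last by rewrite gt_eqF// divr_gt0.
have -> : \int[leb3 R]_x `|(EFin \o h) x| = M%:E.
  by rewrite -hM; apply: eq_integral => x _; rewrite /= ger0_norm.
have -> : \int[leb3 R]_x (`|(EFin \o h) x| `^ (4 / 3)) = H%:E.
  by rewrite -hH; apply: eq_integral => x _; rewrite /= ger0_norm.
rewrite poweR_EFin -!EFinM; case: (coulomb h) (coulomb_ge0 h0) => [r| |]// _.
  rewrite -!EFinM !lee_fin => hle.
  rewrite -(ler_pM2r nN) (le_trans _ (le_trans hle _))// le_eqVlt; apply/orP; left; apply/eqP.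
    by ring.
  by field; rewrite gt_eqF.
by rewrite gt0_muley ?lte_fin ?mulr_gt0.
Qed.

Lemma edist0_eq x y : edist x y = 0%R -> x = y.
Proof.
move=> d0; have := edist_sqr x y; rewrite d0 expr0n/= => /esym/eqP.
rewrite !paddr_eq0 ?addr_ge0 ?sqr_ge0// !sqrf_eq0 !subr_eq0.
move=> /andP[/andP[/eqP e1 /eqP e2] /eqP e3].
by case: x y e1 e2 e3 {d0} => [[? ?] ?] [[? ?] ?] /= -> -> ->.
Qed.

Lemma set1_box x : [set x] = [set x.1.1] `*` [set x.1.2] `*` [set x.2].
Proof.
apply/seteqP; split => [y -> //|[[a b] c] /= [[-> ->] ->]]; by case: x => -[].
Qed.

Lemma measurable_set1_R3 x : measurable [set x].
Proof. by rewrite set1_box; apply: measurableX => //; exact: measurableX. Qed.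

Lemma leb3_set1 x : leb3 R [set x] = 0.
Proof. by rewrite set1_box leb3_box// lebesgue_measure_set1 !mul0e. Qed.

Lemma int_indicZ (b : R) (Q : set (R3 R)) : (0 <= b)%R -> measurable Q ->
  \int[leb3 R]_x (b * \1_Q x)%:E = b%:E * leb3 R Q.
Proof.
move=> b0 mQ; under eq_integral do rewrite EFinM.
rewrite ge0_integralZl_EFin//; last by apply/measurable_EFinP; exact: measurable_indic.
by rewrite integral_indic// setIT.
Qed.

(** The upper end is written 0 + a to match [leb3_cube]. *)
Definition cube a : set (R3 R) :=
  `]0%R, (0 + a)%R[%classic `*` `]0%R, (0 + a)%R[%classic `*` `]0%R, (0 + a)%R[%classic.

Definition uniform_cube (b a : R) (x : R3 R) : R := (b * \1_(cube a) x)%R.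

Lemma measurable_cube a : measurable (cube a).
Proof. by apply: measurableX => //; exact: measurableX. Qed.

Lemma uniform_cube_density p b a : (0 < p)%R -> (0 <= b)%R -> (0 <= a)%R ->
  density p (uniform_cube b a).
Proof.
move=> p0 b0 a0; apply/(densityP _ p0); split.
- by move=> x; rewrite /uniform_cube mulr_ge0.
- by apply: measurable_funM => //; apply: measurable_indic; exact: measurable_cube.
- by rewrite int_indicZ ?leb3_cube -?EFinM ?ltry//; exact: measurable_cube.
- have -> : \int[leb3 R]_x (uniform_cube b a x `^ p)%:E = \int[leb3 R]_x (b `^ p * \1_(cube a) x)%:E.
    apply: eq_integral => x _; rewrite /uniform_cube indicE.
    by case: (_ \in _); rewrite ?mulr1 ?mulr0 ?powR0// gt_eqF.
  by rewrite int_indicZ ?powR_ge0 ?leb3_cube -?EFinM ?ltry//; exact: measurable_cube.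
Qed.

Lemma uniform_cube_mass b a : (0 <= b)%R -> (0 <= a)%R ->
  \int[leb3 R]_x (uniform_cube b a x)%:E = (b * a ^+ 3)%:E.
Proof. by move=> b0 a0; rewrite int_indicZ ?leb3_cube//; exact: measurable_cube. Qed.

(** Any two points of the cube are at distance at most 2 a. *)
Lemma uniform_cube_coulomb b a : (0 <= b)%R -> (0 < a)%R ->
  (b ^+ 2 * a ^+ 5 / 4)%:E <= coulomb (uniform_cube b a).
Proof.
move=> b0 a0; have a0' := ltW a0.
have [f0 mf _ _] := (densityP _ ltr01).1 (uniform_cube_density ltr01 b0 a0').
have mQ := measurable_cube a.
rewrite coulombE mutualE//.
have c0 : (0 <= b / (2 * a) * a ^+ 3)%R by rewrite mulr_ge0 ?divr_ge0 ?exprn_ge0 ?mulr_ge0.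
apply: (@le_trans _ _ ((1 / 2)%:E * \int[leb3 R]_x ((b / (2 * a) * a ^+ 3)%:E * (uniform_cube b a x)%:E))).
  rewrite ge0_integralZl_EFin//; last 2 first.
  - by move=> x _; rewrite lee_fin.
  - exact/measurable_EFinP.
  rewrite uniform_cube_mass// -!EFinM lee_fin le_eqVlt; apply/orP; left; apply/eqP.
  by field; rewrite gt_eqF.
apply: lee_wpmul2l; first by rewrite lee_fin divr_ge0.
apply: ge0_le_integral => //.
- by move=> x _; rewrite -EFinM lee_fin mulr_ge0.
- by apply: emeasurable_funM => //; exact/measurable_EFinP.
- by apply: emeasurable_funM; [exact/measurable_EFinP|exact: measurable_potential].
move=> x _; rewrite muleC /uniform_cube indicE.
have [/set_mem xQ|_] := boolP (x \in cube a); last by rewrite mulr0 !mul0e.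
rewrite mulr1; apply: lee_wpmul2l; first by rewrite lee_fin.
apply: (@le_trans _ _ (\int[leb3 R]_y (b / (2 * a) * \1_(cube a) y)%:E)).
  by rewrite int_indicZ ?leb3_cube ?divr_ge0 ?mulr_ge0.
apply: ae_ge0_le_integral => //.
- by move=> y _; rewrite lee_fin mulr_ge0 ?divr_ge0 ?mulr_ge0.
- by apply/measurable_EFinP; apply: measurable_funM => //; exact: measurable_indic.
- by move=> y _; rewrite lee_fin mulr_ge0 ?invr_ge0 ?edist_nonneg ?mulr_ge0.
- by apply/measurable_EFinP; apply: measurable_funM => //; exact: measurable_inv_edist1.
(* at y = x the kernel is 0, so the pointwise comparison fails there *)
exists [set x]; split; [exact: measurable_set1_R3|exact: leb3_set1|].
move=> y /=; apply: contra_notP => /eqP yx _; rewrite lee_fin /uniform_cube indicE.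
have [/set_mem yQ|_] := boolP (y \in cube a); last by rewrite !mulr0 mul0r.
rewrite !mulr1; apply: ler_wpM2l => //.
have d0 : (0 < edist x y)%R.
  rewrite lt_neqAle edist_nonneg andbT eq_sym; apply: contra yx => /eqP d0.
  by apply/eqP/esym/edist0_eq.
rewrite lef_pV2 ?posrE ?mulr_gt0//.
rewrite /edist le_enorm2 ?mulr_ge0// -/(edist x y) edist_sqr.
move: xQ yQ; rewrite /cube/= !in_itv/= => -[[/andP[? ?] /andP[? ?]] /andP[? ?]].
move=> -[[/andP[? ?] /andP[? ?]] /andP[? ?]].
have aux (u v : R) : (0 < u -> u < 0 + a -> 0 < v -> v < 0 + a -> (u - v) ^+ 2 <= a ^+ 2)%R.
  by move=> ? ? ? ?; rewrite -(@real_normK _ (u - v))// ?num_real// ler_pXn2r ?nnegrE// ler_norml; apply/andP; split; lra.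
have -> : ((2 * a) ^+ 2 = a ^+ 2 + a ^+ 2 + a ^+ 2 + a ^+ 2)%R by ring.
rewrite ler_wpDr ?sqr_ge0//; apply: lerD; first apply: lerD; exact: aux.
Qed.

End Bounds.

(** * Comparing a minimizer with parts of itself *)

Section Variational.
Context {R : realType}.
Implicit Types (x y : R3 R) (f g h rho : R3 R -> R).

Definition energy (kappa q : R) (tau : R3 R -> R) rho : \bar R :=
  (\int[leb3 R]_x fermi_density q tau (rho x) - kappa%:E * coulomb rho)%E.

Definition minimizes kappa q tau p N rho : Prop :=
  admissible p N rho /\
  forall rho', admissible p N rho' -> (energy kappa q tau rho <= energy kappa q tau rho')%E.

(** The coefficient of s ^ (5/3) in the nonrelativistic kinetic energy density. *)
Definition kinetic_const (q m : R) : R :=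
  q / (8 * pi ^+ 3) / (2 * m) * moment 2 * (6 * pi ^+ 2 / q) `^ (5 / 3).

Lemma kinetic_const_gt0 q m : 0 < q -> 0 < m -> 0 < kinetic_const q m.
Proof.
move=> q0 m0; have p3 : 0 < 8 * pi ^+ 3 :> R by rewrite mulr_gt0 ?exprn_gt0 ?pi_gt0.
have C0 := fermi_const_gt0 q0.
by rewrite /kinetic_const mulr_gt0 ?powR_gt0// mulr_gt0 ?moment_gt0// !divr_gt0// mulr_gt0.
Qed.

Section Fixed.
Variables (kappa q m p n A : R) (tau : R3 R -> R).
Hypotheses (kappa0 : 0 < kappa) (q0 : 0 < q) (m0 : 0 < m) (n0 : 0 < n).
Hypotheses (p43 : 4 / 3 <= p) (tauP : dispersion m tau).

Hypothesis A0 : 0 < A.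
Hypothesis AP : forall s, 0 <= s -> (fermi_density q tau s <= (A * s `^ (5 / 3))%:E)%E.

Let e0 : R := kappa ^+ 2 / (64 * A) * n ^+ 7.
Let p0 : 0 < p. Proof. by apply: lt_le_trans p43; rewrite divr_gt0. Qed.

Lemma energy_gap_gt0 : 0 < e0.
Proof. by rewrite mulr_gt0 ?exprn_gt0// divr_gt0 ?exprn_gt0// mulr_gt0. Qed.

(** On a cube of side a the kinetic energy is at most A n ^ 5 / a ^ 2 and the attraction
at least kappa n ^ 6 / (4 a); the difference is smallest at a = 8 A / (kappa n). *)
Lemma trial_energy : exists2 rho, admissible p (n ^+ 3) rho &
  (energy kappa q tau rho <= (- e0)%:E)%E.
Proof.
pose a := 8 * A / (kappa * n); pose b := n ^+ 3 / a ^+ 3.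
have a0 : 0 < a by rewrite /a divr_gt0 ?mulr_gt0.
have b0 : 0 < b by rewrite /b divr_gt0 ?exprn_gt0.
have mass : b * a ^+ 3 = n ^+ 3 by rewrite /b divfK// expf_neq0// gt_eqF.
exists (uniform_cube b a).
  split; first exact: uniform_cube_density p0 (ltW b0) (ltW a0).
  by rewrite uniform_cube_mass ?mass// ltW.
have mQ := measurable_cube a.
have kin : (\int[leb3 R]_x fermi_density q tau (uniform_cube b a x) <= (A * b `^ (5 / 3) * a ^+ 3)%:E)%E.
  apply: (@le_trans _ _ (\int[leb3 R]_x (A * b `^ (5 / 3) * \1_(cube a) x)%:E)%E).
    apply: ge0_le_integral => //.
    - by move=> x _; apply: fermi_density_ge0 q0 tauP _.
    - apply: (measurable_fermi_density q tauP).
      by apply: measurable_funM => //; exact: measurable_indic.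
    - by apply/measurable_EFinP; apply: measurable_funM => //; exact: measurable_indic.
    - move=> x _; rewrite /uniform_cube indicE; case: (_ \in _).
        by rewrite !mulr1; apply: AP; rewrite ltW.
      by rewrite !mulr0 fermi_density0.
  rewrite int_indicZ ?leb3_cube ?(ltW a0)// mulr_ge0 ?powR_ge0 ?ltW//.
have cou := uniform_cube_coulomb (ltW b0) a0.
have cou' : (kappa%:E * (b ^+ 2 * a ^+ 5 / 4)%:E <= kappa%:E * coulomb (uniform_cube b a))%E.
  by apply: lee_wpmul2l => //; rewrite lee_fin ltW.
apply: le_trans (leeB kin cou') _.
rewrite -EFinM -EFinB lee_fin.
have bpow : b `^ (5 / 3) * a ^+ 3 = n ^+ 5 / a ^+ 2.
  have -> : b = (n / a) ^+ 3 by rewrite /b; field; rewrite gt_eqF.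
  have na0 : 0 <= n / a by rewrite divr_ge0 ?ltW.
  rewrite -(powR_mulrn 3 na0) -powRrM (_ : 3%:R * (5 / 3) = 5%:R); last by field.
  by rewrite powR_mulrn//; field; rewrite gt_eqF.
rewrite -mulrA bpow le_eqVlt; apply/orP; left; apply/eqP.
rewrite /e0 /b /a; field; by rewrite !gt_eqF.
Qed.

Variable rho : R3 R -> R.
Hypothesis rhoP : minimizes kappa q tau p (n ^+ 3) rho.

Let r0 x : 0 <= rho x. Proof. by case: rhoP => -[[]]. Qed.
Let mr : measurable_fun setT rho.
Proof. by case: rhoP => -[/(densityP _ p0)[]]. Qed.
Let massr : (\int[leb3 R]_x (rho x)%:E = (n ^+ 3)%:E)%E.
Proof. by case: rhoP => -[]. Qed.
Let n30 : 0 < n ^+ 3. Proof. exact: exprn_gt0. Qed.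

Section Nstar.
Variable Nstar : R.
Hypotheses (Nstar0 : 0 < Nstar) (cb : coulomb_bound kappa q Nstar).

Lemma coulomb_lty f : density p f -> (coulomb f < +oo)%E.
Proof.
move=> /(density_lower_exponent _ p43) df.
have p1 : 1 <= 4 / 3 :> R by lra.
have {}df := df p1; have p40 : 0 < 4 / 3 :> R by lra.
have [f0 mf f1 f4] := (densityP _ p40).1 df.
have fM x : setT x -> (0 <= (f x)%:E)%E by rewrite lee_fin.
have fH x : setT x -> (0 <= (f x `^ (4 / 3))%:E)%E by rewrite lee_fin powR_ge0.
have [M M0 eM] := ge0_lty_real (integral_ge0 (leb3 R) fM) f1.
have [H H0 eH] := ge0_lty_real (integral_ge0 (leb3 R) fH) f4.
have := coulomb_bound_real kappa0 Nstar0 cb df eM eH.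
by case: (coulomb f) => [r| |]//; rewrite ?ltry// gt0_muley ?lte_fin.
Qed.

(** The infinite values have to be excluded first: the Coulomb energy is finite by the
Coulomb bound, and then the kinetic energy is finite because the total energy is
negative. *)
Lemma minimizer_data : exists K D : R, [/\ 0 <= K, 0 <= D,
  (\int[leb3 R]_x fermi_density q tau (rho x) = K%:E)%E, coulomb rho = D%:E
  & e0 <= kappa * D - K].
Proof.
have [rho1 ad1 le1] := trial_energy.
have := le_trans (rhoP.2 _ ad1) le1; rewrite /energy.
have [|D D0 ->] := ge0_lty_real (coulomb_ge0 r0); first by apply: coulomb_lty; case: rhoP => -[].
have : (0 <= \int[leb3 R]_x fermi_density q tau (rho x))%E.
  by apply: integral_ge0 => x _; apply: fermi_density_ge0 q0 tauP _.
case: (\int[leb3 R]_x _)%E => [K| |]//; rewrite lee_fin => K0.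
by rewrite -EFinM -EFinB lee_fin => h; exists K, D; split => //; lra.
Qed.

(** Multiplying rho1 by b = n ^ 3 / N1 >= 1 restores the mass; it multiplies the Coulomb
energy by b ^ 2 and the kinetic energy by at most b ^ 2.  The squares are kept on both
sides so that N1 = 0 is allowed. *)
Lemma sub_energy K D rho1 : (\int[leb3 R]_x fermi_density q tau (rho x) = K%:E)%E ->
  coulomb rho = D%:E ->
  measurable_fun setT rho1 -> (forall x, 0 <= rho1 x <= rho x) ->
  exists N1 K1 D1 : R, [/\ 0 <= N1 <= n ^+ 3,
    (\int[leb3 R]_x (rho1 x)%:E = N1%:E)%E,
    (\int[leb3 R]_x fermi_density q tau (rho1 x) = K1%:E)%E, coulomb rho1 = D1%:E
    & K1 <= K /\ N1 ^+ 2 * (K - kappa * D) <= (n ^+ 3) ^+ 2 * (K1 - kappa * D1)].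
Proof.
move=> KE DE mr1 h.
have h0 x : 0 <= rho1 x by case/andP: (h x).
have h1 x : rho1 x <= rho x by case/andP: (h x).
have rd : density p rho by case: rhoP => -[].
have r1d : density p rho1.
  have := density_scaled_part p0 ler01 rd mr1 h.
  by rewrite (_ : (fun x => 1 * rho1 x) = rho1)//; apply/funext => x; rewrite mul1r.
have N1n : (\int[leb3 R]_x (rho1 x)%:E <= (n ^+ 3)%:E)%E.
  rewrite -massr; apply: ge0_le_integral => //.
  - by move=> x _; rewrite lee_fin.
  - exact/measurable_EFinP.
  - exact/measurable_EFinP.
  - by move=> x _; rewrite lee_fin.
have mj f : measurable_fun setT f -> measurable_fun setT (fun x => fermi_density q tau (f x)).
  exact: (measurable_fermi_density q tauP).
have j0 (s : R) : (0 <= fermi_density q tau s)%E := fermi_density_ge0 q0 tauP s.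
have K1K : (\int[leb3 R]_x fermi_density q tau (rho1 x) <= K%:E)%E.
  rewrite -KE; apply: ge0_le_integral; [by []|by move=> x _; exact: j0|exact: mj|exact: mj|].
  by move=> x _; exact: (fermi_density_mono q0 tauP (h0 x) (h1 x)).
have [N1 N10 N1E] : exists2 N1, 0 <= N1 & (\int[leb3 R]_x (rho1 x)%:E = N1%:E)%E.
  apply: ge0_lty_real; last exact: le_lt_trans N1n (ltry _).
  by apply: integral_ge0 => x _; rewrite lee_fin.
have [K1 K10 K1E] : exists2 K1, 0 <= K1 & (\int[leb3 R]_x fermi_density q tau (rho1 x) = K1%:E)%E.
  by apply: ge0_lty_real; [exact: integral_ge0|exact: le_lt_trans K1K (ltry _)].
have [D1 D10 D1E] := ge0_lty_real (coulomb_ge0 h0) (coulomb_lty r1d).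
move: N1n K1K; rewrite N1E K1E !lee_fin => N1n K1K.
exists N1, K1, D1; split => //; first by rewrite N10 N1n.
split => //.
move: N10; rewrite le_eqVlt => /predU1P[N10|N10].
  have -> : D1 = 0.
    suff : (coulomb rho1 = 0)%E by rewrite D1E => -[].
    rewrite coulombE mutualE//.
    have /ae_eq_integral_abs : (\int[leb3 R]_(x in setT) `|(rho1 x)%:E| = 0)%E.
      by rewrite -[RHS]/(0%:E) N10 -N1E; apply: eq_integral => x _; rewrite /= ger0_norm.
    move=> /(_ measurableT ((measurable_EFinP _ _).2 mr1)) r10.
    rewrite (ae_eq_integral (cst 0%E))//.
    - by rewrite integral_cst// mul0e mule0.
    - by apply: emeasurable_funM; [exact/measurable_EFinP|exact: measurable_potential].
    - by apply: filterS r10 => x /(_ I) /= r1x _; rewrite r1x mul0e.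
  by rewrite -N10 expr0n/= mul0r mulr0 subr0 mulr_ge0// sqr_ge0.
pose b := n ^+ 3 / N1.
have b1 : 1 <= b by rewrite /b ler_pdivlMr// mul1r.
have b0 : 0 <= b := le_trans ler01 b1.
have bad : admissible p (n ^+ 3) (fun x => b * rho1 x).
  split; first exact: density_scaled_part p0 b0 rd mr1 h.
  under eq_integral do rewrite EFinM.
  rewrite ge0_integralZl_EFin//; last 2 first.
  - by move=> x _; rewrite lee_fin.
  - exact/measurable_EFinP.
  by rewrite N1E -EFinM /b divfK// gt_eqF.
have kin : (\int[leb3 R]_x fermi_density q tau (b * rho1 x)%R <= (b ^+ 2 * K1)%:E)%E.
  rewrite EFinM -K1E -ge0_integralZl_EFin ?sqr_ge0//; last exact: mj.
  apply: ge0_le_integral => //.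
  - by apply: mj; exact: measurable_funM.
  - by apply: emeasurable_funM => //; exact: mj.
  - by move=> x _; exact: (fermi_densityZ q0 tauP b1 (h0 x)).
have er : energy kappa q tau rho = (K - kappa * D)%:E.
  by rewrite /energy KE DE -EFinM -EFinB.
have eb : (energy kappa q tau (fun x => b * rho1 x)%R <=
    (b ^+ 2 * K1 - kappa * (b ^+ 2 * D1))%:E)%E.
  have cE : (kappa%:E * coulomb (fun x => b * rho1 x)%R = (kappa * (b ^+ 2 * D1))%:E)%E.
    by rewrite coulombZ// D1E.
  by rewrite /energy EFinB cE; apply: leeB.
have := le_trans (rhoP.2 _ bad) eb; rewrite er lee_fin => le1.
have N2 : 0 <= N1 ^+ 2 by exact: sqr_ge0.
apply: le_trans (ler_wpM2l N2 le1) _; rewrite le_eqVlt; apply/orP; left; apply/eqP.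
by rewrite /b; field; rewrite gt_eqF.
Qed.

End Nstar.
End Fixed.
End Variational.

(** * Lower bounds on the potential and on the supremum of a minimizer *)

Section SupBound.
Context {R : realType}.
Implicit Types (x y : R3 R) (f g h rho : R3 R -> R).

Lemma mutualDr f g h : (forall x, 0 <= f x) -> (forall x, 0 <= g x) ->
  (forall x, 0 <= h x) ->
  measurable_fun setT f -> measurable_fun setT g -> measurable_fun setT h ->
  (mutual h (fun x => f x + g x)%R = mutual h f + mutual h g)%E.
Proof.
move=> f0 g0 h0 mf mg mh.
have mfg : measurable_fun setT (fun x => f x + g x)%R by exact: measurable_funD.
have fg0 x : 0 <= f x + g x by rewrite addr_ge0.
have -> := mutualC h0 fg0 mh mfg; have -> := mutualDl f0 g0 h0 mf mg mh.
by have -> := mutualC f0 h0 mf mh; have -> := mutualC g0 h0 mg mh.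
Qed.

Lemma pow43E (s : R) : 0 <= s -> s `^ (4 / 3) = s * s `^ (1 / 3).
Proof.
rewrite le_eqVlt => /predU1P[<-|s0]; first by rewrite mul0r powR0// gt_eqF// divr_gt0.
rewrite -{2}(powRr1 (ltW s0)) -powRD; last by rewrite (gt_eqF s0) implybT.
by congr powR; field.
Qed.

(** With h = s - u ^ 3 and v the cube root of s, the increment s v - u ^ 3 u is at least
h v, and v dominates both u and the cube root of h. *)
Lemma pow43_incr (u s : R) : 0 <= u -> u ^+ 3 <= s ->
  (s - u ^+ 3) `^ (4 / 3) + u * (s - u ^+ 3) <= 2 * (s `^ (4 / 3) - (u ^+ 3) `^ (4 / 3)).
Proof.
move=> u0 us; have u30 : 0 <= u ^+ 3 by exact: exprn_ge0.
have s0 := le_trans u30 us; have h0 : 0 <= s - u ^+ 3 by rewrite subr_ge0.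
have ue : (u ^+ 3) `^ (1 / 3) = u.
  by rewrite -powR_mulrn// -powRrM (_ : 3%:R * (1 / 3) = 1) ?powRr1//; field.
rewrite !pow43E// ue.
have mono (v w : R) : 0 <= v -> v <= w -> v `^ (1 / 3) <= w `^ (1 / 3).
  by move=> v0 vw; apply: ge0_ler_powR; rewrite ?nnegrE ?divr_ge0 ?(le_trans v0 vw).
have v1 : u <= s `^ (1 / 3) by rewrite -ue; exact: mono.
have v2 : (s - u ^+ 3) `^ (1 / 3) <= s `^ (1 / 3) by apply: mono => //; rewrite gerBl.
move: (u ^+ 3) (s `^ (1 / 3)) ((s - u ^+ 3) `^ (1 / 3)) v1 v2 u30 us s0 h0 => t v w v1 v2 t0 ts s0 h0.
have a1 : (s - t) * w <= (s - t) * v by apply: ler_wpM2l.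
have a2 : t * u <= t * v by apply: ler_wpM2l.
have a3 : s * u <= s * v by apply: ler_wpM2l.
lra.
Qed.

Section Fixed.
Variables (kappa q m p n A Nstar : R) (tau : R3 R -> R).
Hypotheses (kappa0 : 0 < kappa) (q0 : 0 < q) (m0 : 0 < m) (n0 : 0 < n).
Hypotheses (p43 : 4 / 3 <= p) (tauP : dispersion m tau).
Hypothesis A0 : 0 < A.
Hypothesis AP : forall s, 0 <= s -> (fermi_density q tau s <= (A * s `^ (5 / 3))%:E)%E.
Hypotheses (Nstar0 : 0 < Nstar) (cb : coulomb_bound kappa q Nstar).
Variable rho : R3 R -> R.
Hypothesis rhoP : minimizes kappa q tau p (n ^+ 3) rho.

Let p0 : 0 < p. Proof. by apply: lt_le_trans p43; rewrite divr_gt0. Qed.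

Lemma minimizer_ge0 x : 0 <= rho x. Proof. by case: rhoP => -[[]]. Qed.
Lemma minimizer_measurable : measurable_fun setT rho.
Proof. by case: rhoP => -[/(densityP _ p0)[]]. Qed.
Lemma minimizer_mass : (\int[leb3 R]_x (rho x)%:E = (n ^+ 3)%:E)%E.
Proof. by case: rhoP => -[]. Qed.

Let r0 := minimizer_ge0.
Let mr := minimizer_measurable.

(** The comparison with the part f of rho, in real numbers; E is the Coulomb energy lost
with the other part g. *)
Lemma split_energy f g : measurable_fun setT f -> measurable_fun setT g ->
  (forall x, 0 <= f x) -> (forall x, 0 <= g x) -> (forall x, f x + g x = rho x) ->
  exists K D N1 K1 D1 d E : R, [/\ 
    (\int[leb3 R]_x (f x)%:E = N1%:E)%E /\ (\int[leb3 R]_x (g x)%:E = d%:E)%E,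
    (\int[leb3 R]_x fermi_density q tau (rho x) = K%:E)%E /\
    (\int[leb3 R]_x fermi_density q tau (f x) = K1%:E)%E,
    (coulomb g + mutual g f)%E = E%:E /\ D = D1 + E,
    [/\ 0 <= N1, 0 <= d & N1 + d = n ^+ 3] &
    [/\ kappa ^+ 2 / (64 * A) * n ^+ 7 <= kappa * D - K, K1 <= K &
    N1 ^+ 2 * (K - kappa * D) <= n ^+ 3 ^+ 2 * (K1 - kappa * D1)]].
Proof.
move=> mf mg f0 g0 fg.
have [K [D [K0 D0 KE DE KD]]] :=
  minimizer_data kappa0 q0 n0 p43 tauP A0 AP rhoP Nstar0 cb.
have hf x : 0 <= f x <= rho x by rewrite f0 -fg lerDl g0.
have [N1 [K1 [D1 [/andP[N10 N1n] N1E K1E D1E [K1K sub]]]]] :=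
  sub_energy kappa0 q0 p43 tauP rhoP Nstar0 cb KE DE mf hf.
have rE : rho = (fun x => f x + g x) by apply/funext => x; rewrite fg.
have gE : (\int[leb3 R]_x (g x)%:E = (n ^+ 3 - N1)%:E)%E.
  have := minimizer_mass; rewrite rE; under eq_integral do rewrite EFinD.
  rewrite ge0_integralD; [|by []|by move=> x _; rewrite lee_fin|exact/measurable_EFinP|by move=> x _; rewrite lee_fin|exact/measurable_EFinP].
  by rewrite N1E EFinB => <-; rewrite [(N1%:E + _)%E]addeC addeK.
have cE : (coulomb g + mutual g f)%E = (D - D1)%:E.
  have := coulombD f0 g0 mf mg; rewrite -rE DE D1E EFinB -addeA => ->.
  by rewrite [(D1%:E + _)%E]addeC addeK.
exists K, D, N1, K1, D1, (n ^+ 3 - N1), (D - D1); split => //.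
- by split => //; ring.
- by split => //; [rewrite subr_ge0|ring].
Qed.

(** Removing g costs at most kappa P d of attraction, d being the mass of g.  By
[split_energy] the energy of the rest is at least E(rho) (1 - d / n ^ 3) ^ 2, so that the
cost is at least - E(rho) d / n ^ 3; the mass d cancels. *)
Lemma potential_lower (P : R) f g : measurable_fun setT f -> measurable_fun setT g ->
  (forall x, 0 <= f x) -> (forall x, 0 <= g x) -> (forall x, f x + g x = rho x) ->
  (\int[leb3 R]_x (g x)%:E != 0)%E -> 0 <= P ->
  (forall x, g x != 0 -> (potential rho x <= P%:E)%E) ->
  kappa / (64 * A) * n ^+ 4 <= P.
Proof.
move=> mf mg f0 g0 fg g1 P0 gP.
have [K [D [N1 [K1 [D1 [d [E [[N1E dE] [KE K1E] [EE DE] [N10 d0 Nd] [KD K1K sub]]]]]]]]] :=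
  split_energy mf mg f0 g0 fg.
have {g1 d0}d0 : 0 < d.
  by rewrite lt_neqAle d0 andbT eq_sym; apply: contra g1 => /eqP d00; rewrite dE d00.
have EP : E <= P * d.
  rewrite -lee_fin -EE EFinM -dE.
  apply: le_trans (mutual_le_mass g0 r0 mg mr P0 gP).
  have -> : mutual g rho = (mutual g f + mutual g g)%E.
    rewrite -(mutualDr f0 g0 g0 mf mg mg); congr mutual.
    by apply/funext => x; rewrite fg.
  rewrite addeC leeD2l// coulombE -[leRHS]mul1e.
  by apply: lee_wpmul2r; [exact: mutual_ge0|rewrite lee_fin; lra].
have n30 : 0 < n ^+ 3 by exact: exprn_gt0.
have n3E : n ^+ 7 = n ^+ 3 * n ^+ 4 by rewrite -exprD.
have e64 : kappa ^+ 2 / (64 * A) = kappa * (kappa / (64 * A)) by ring.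
move: KD; rewrite n3E e64.
set c := kappa / (64 * A) => KD.
have c0 : 0 <= c by rewrite /c divr_ge0 ?mulr_ge0 ?(ltW kappa0) ?(ltW A0).
have X : kappa * c * (n ^+ 3 * n ^+ 4) * (d * n ^+ 3) <= n ^+ 3 ^+ 2 * (kappa * (P * d)).
  apply: (@le_trans _ _ ((kappa * D - K) * (n ^+ 3 ^+ 2 - N1 ^+ 2))).
    apply: (@le_trans _ _ ((kappa * D - K) * (d * n ^+ 3))).
      by rewrite ler_wpM2r// mulr_ge0 ?ltW.
    apply: ler_wpM2l.
      apply: le_trans KD; apply: mulr_ge0; first by apply: mulr_ge0 => //; exact: ltW.
      by apply: mulr_ge0; apply: exprn_ge0; exact: ltW.
    rewrite -Nd; nra.
  have h1 : n ^+ 3 ^+ 2 * (K1 - kappa * D1) <= n ^+ 3 ^+ 2 * (K - kappa * (D - P * d)).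
    apply: ler_wpM2l; first exact: sqr_ge0.
    apply: lerB => //; apply: ler_wpM2l; first exact: ltW.
    by rewrite DE; lra.
  lra.
have Y : 0 < n ^+ 3 ^+ 2 * kappa * d by rewrite !mulr_gt0// exprn_gt0.
rewrite -(ler_pM2l Y); lra.
Qed.

(** The energy of a minimizer is negative, so its attraction has to exceed the gap of
[trial_energy], whereas a cap on the density caps the potential.  The constant is
1056 = 64 * 33 / 2. *)
Lemma ess_bound_lower (u : R) : 0 < u -> {ae leb3 R, forall x, rho x <= u ^+ 3} ->
  kappa / (1056 * A) * n ^+ 2 <= u.
Proof.
move=> u0 ru.
have [K [D [K0 D0 KE DE KD]]] :=
  minimizer_data kappa0 q0 n0 p43 tauP A0 AP rhoP Nstar0 cb.
have mass : (\int[leb3 R]_y (rho y)%:E <= (n ^+ 3)%:E)%E by rewrite minimizer_mass.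
have DP : D <= 1 / 2 * (33 * u * n ^+ 2 * n ^+ 3).
  rewrite -lee_fin -DE coulombE [X in (_ <= X)%E]EFinM.
  apply: lee_wpmul2l; first by rewrite lee_fin.
  rewrite [X in (_ <= X)%E]EFinM -minimizer_mass; apply: mutual_le_mass => //.
  - by rewrite mulr_ge0 ?exprn_ge0 ?mulr_ge0 ?(ltW u0) ?(ltW n0).
  - by move=> x _; exact: (potential_bound x n0 u0 mr r0 mass ru).
have n5 : 0 < kappa * n ^+ 5 by rewrite mulr_gt0// exprn_gt0.
rewrite -(ler_pM2l n5).
have KD' : kappa ^+ 2 / (64 * A) * n ^+ 7 <= kappa * (1 / 2 * (33 * u * n ^+ 2 * n ^+ 3)).
  apply: (le_trans KD); rewrite lerBlDr ler_wpDr// ler_wpM2l// ltW//.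
have : kappa * n ^+ 5 * (kappa / (1056 * A) * n ^+ 2) = (kappa ^+ 2 / (64 * A) * n ^+ 7) * (2 / 33).
  by field; rewrite gt_eqF.
move=> ->; apply: (@le_trans _ _ (kappa * (1 / 2 * (33 * u * n ^+ 2 * n ^+ 3)) * (2 / 33))).
  by rewrite ler_wpM2r.
by rewrite le_eqVlt; apply/orP; left; apply/eqP; field.
Qed.

End Fixed.
End SupBound.

(** * Upper bound on the supremum of a minimizer *)

Section Truncation.
Context {R : realType}.
Implicit Types (x y : R3 R) (f g h rho : R3 R -> R).

Section Fixed.
Variables (kappa q m p n A Nstar : R) (tau : R3 R -> R).
Hypotheses (kappa0 : 0 < kappa) (q0 : 0 < q) (m0 : 0 < m) (n0 : 0 < n).
Hypotheses (p43 : 4 / 3 <= p) (tauP : dispersion m tau).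
Hypothesis A0 : 0 < A.
Hypothesis AP : forall s, 0 <= s -> (fermi_density q tau s <= (A * s `^ (5 / 3))%:E)%E.
Hypotheses (Nstar0 : 0 < Nstar) (cb : coulomb_bound kappa q Nstar).
Variables (L B0 B1 : R).
Hypothesis LB1 : L * B1 = 2 * n ^+ 2 * (K_cl q / Nstar `^ (2 / 3) + 66 * kappa).
Hypothesis LB0 : 0 < m * L ^+ 2 * B0.
Hypothesis incrP : forall s t, 0 <= t -> t <= s ->
  (fermi_density q tau t + (L * B1 * (s `^ (4 / 3) - t `^ (4 / 3)))%:E <=
   fermi_density q tau s + (m * L ^+ 2 * B0 * (s - t))%:E)%E.
Variable rho : R3 R -> R.
Hypothesis rhoP : minimizes kappa q tau p (n ^+ 3) rho.

Let p0 : 0 < p. Proof. by apply: lt_le_trans p43; rewrite divr_gt0. Qed.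
Let r0 := minimizer_ge0 rhoP.
Let mr := minimizer_measurable p43 rhoP.

(** Compares rho with its truncation f at the height u ^ 3.  The value of L B1 is chosen
to dominate the loss of attraction caused by removing g = rho - f and to leave
33 kappa n ^ 2 u times the mass of g for the error term of [fermi_density_incr]. *)
Lemma ess_bound_upper (u : R) : 0 < u ->
  m * L ^+ 2 * B0 < 33 * kappa * n ^+ 2 * u ->
  {ae leb3 R, forall x, rho x <= u ^+ 3}.
Proof.
move=> u0 Lu; have u30 : 0 <= u ^+ 3 by rewrite exprn_ge0 ?ltW.
pose f x := Num.min (rho x) (u ^+ 3); pose g x := rho x - f x.
have mf : measurable_fun setT f by apply: measurable_minr.
have mg : measurable_fun setT g by exact: measurable_funB.
have f0 x : 0 <= f x by rewrite /f le_min r0.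
have fu x : f x <= u ^+ 3 by rewrite /f ge_min lexx orbT.
have fr x : f x <= rho x by rewrite /f ge_min lexx.
have g0 x : 0 <= g x by rewrite subr_ge0.
have fg x : f x + g x = rho x by rewrite /g; ring.
have [g1|g1] := eqVneq (\int[leb3 R]_x (g x)%:E)%E 0%E.
  have /ae_eq_integral_abs : (\int[leb3 R]_(x in setT) `|(g x)%:E| = 0)%E.
    by rewrite -[RHS]g1; apply: eq_integral => x _; rewrite /= ger0_norm.
  move=> /(_ measurableT ((measurable_EFinP _ _).2 mg)).
  apply: filterS => x /(_ I) /= -[gx]; rewrite -(fg x) gx addr0; exact: fu.
exfalso.
have C0 : 0 <= K_cl q / Nstar `^ (2 / 3).
  apply: divr_ge0; last exact: powR_ge0.
  by apply: mulr_ge0; [exact: divr_ge0|exact: powR_ge0].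
have [K [D [N1 [K1 [D1 [d [E [[N1E dE] [KE K1E] [EE DE] [N10 d0 Nd] [KD K1K sub]]]]]]]]] :=
  split_energy kappa0 q0 n0 p43 tauP A0 AP Nstar0 cb rhoP mf mg f0 g0 fg.
have {g1 d0}d0 : 0 < d.
  by rewrite lt_neqAle d0 andbT eq_sym; apply: contra g1 => /eqP d00; rewrite dE d00.
have n30 : 0 < n ^+ 3 by exact: exprn_gt0.
have dg : density (4 / 3) g.
  have p1 : 1 <= 4 / 3 :> R by lra.
  have rd : density (4 / 3) rho by apply: (density_lower_exponent p1 p43); case: rhoP => -[].
  have gr x : 0 <= g x <= rho x by rewrite g0 -fg lerDr f0.
  have p40 : 0 < 4 / 3 :> R by lra.
  have := density_scaled_part p40 ler01 rd mg gr.
  by rewrite (_ : (fun x => 1 * g x) = g)//; apply/funext => x; rewrite mul1r.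
have mg43 : measurable_fun setT (fun x => (g x `^ (4 / 3))%:E).
  by apply/measurable_EFinP; exact: (measurableT_comp (measurable_powR _) mg).
have [H H0 HE] : exists2 H, 0 <= H & (\int[leb3 R]_x (g x `^ (4 / 3))%:E = H%:E)%E.
  apply: ge0_lty_real; first by apply: integral_ge0 => x _; rewrite lee_fin powR_ge0.
  by have p40 : 0 < 4 / 3 :> R by [lra|]; case/(densityP _ p40): dg.
(* the self-energy of g by the Coulomb bound, its interaction with f by the potential *)
have EH : kappa * E <= K_cl q / Nstar `^ (2 / 3) * H * n ^+ 2 + kappa * (33 * u * n ^+ 2 * d).
  rewrite -lee_fin EFinM -EE ge0_muleDr ?coulomb_ge0 ?mutual_ge0// EFinD.
  apply: leeD.
    apply: le_trans (coulomb_bound_real kappa0 Nstar0 cb dg dE HE) _; rewrite lee_fin.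
    apply: ler_wpM2l.
      by rewrite !mulr_ge0 ?powR_ge0 ?invr_ge0 ?powR_ge0.
    have -> : n ^+ 2 = (n ^+ 3) `^ (2 / 3).
      rewrite -[in RHS](powR_mulrn 3 (ltW n0)) -powRrM (_ : 3%:R * (2 / 3) = 2%:R); last by field.
      by rewrite powR_mulrn// ltW.
    by apply: ge0_ler_powR; rewrite ?nnegrE ?divr_ge0 ?(ltW d0) ?(ltW n30)// -Nd lerDr.
  rewrite EFinM; apply: lee_wpmul2l; first by rewrite lee_fin ltW.
  rewrite EFinM -dE; apply: mutual_le_mass => //.
    by apply: mulr_ge0; [apply: mulr_ge0 => //; exact: ltW|exact: sqr_ge0].
  move=> x _; apply: (potential_bound x n0 u0 mf f0).
    by rewrite N1E lee_fin -Nd lerDl ltW.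
  exact: aeW.
(* half of L * B1, because of the factor 2 in pow43_incr *)
pose c1 := n ^+ 2 * (K_cl q / Nstar `^ (2 / 3) + 66 * kappa).
have c10 : 0 <= c1.
  by apply: mulr_ge0; [exact: sqr_ge0|apply: addr_ge0 => //; apply: mulr_ge0 => //; exact: ltW].
have KH : K1 + c1 * (H + u * d) <= K + m * L ^+ 2 * B0 * d.
  have mj v : measurable_fun setT v -> measurable_fun setT (fun x => fermi_density q tau (v x)).
    exact: (measurable_fermi_density q tauP).
  have j0 (s : R) : (0 <= fermi_density q tau s)%E := fermi_density_ge0 q0 tauP s.
  have mgE : measurable_fun setT (fun x => (g x)%:E) by exact/measurable_EFinP.
  have g0E x : setT x -> (0 <= (g x)%:E)%E by rewrite lee_fin.
  have LB00 := ltW LB0; have u0' := ltW u0.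
  have g43 x : setT x -> (0 <= (g x `^ (4 / 3))%:E)%E by rewrite lee_fin powR_ge0.
  have lhs : (\int[leb3 R]_x (fermi_density q tau (f x) +
      c1%:E * ((g x `^ (4 / 3))%:E + u%:E * (g x)%:E)) = (K1 + c1 * (H + u * d))%:E)%E.
    have mug : measurable_fun setT (fun x => u%:E * (g x)%:E)%E by exact: emeasurable_funM.
    have ug0 x : setT x -> (0 <= u%:E * (g x)%:E)%E.
      by move=> Tx; apply: mule_ge0; [rewrite lee_fin|exact: g0E].
    have mug' : measurable_fun setT (fun x => (g x `^ (4 / 3))%:E + u%:E * (g x)%:E)%E.
      exact: emeasurable_funD.
    have ug0' x : setT x -> (0 <= (g x `^ (4 / 3))%:E + u%:E * (g x)%:E)%E.
      by move=> Tx; apply: adde_ge0; [exact: g43|exact: ug0].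
    rewrite ge0_integralD; [|by []|by move=> x _; exact: j0|exact: mj| |]; last 2 first.
    - by move=> x Tx; apply: mule_ge0; [rewrite lee_fin|exact: ug0'].
    - exact: emeasurable_funM.
    rewrite K1E EFinD [(c1 * _)%:E]EFinM; congr (_ + _)%E.
    rewrite (ge0_integralZl_EFin _ measurableT ug0' mug' c10); congr (_ * _)%E.
    rewrite (ge0_integralD _ measurableT g43 mg43 ug0 mug) HE EFinD [(u * d)%:E]EFinM; congr (_ + _)%E.
    by rewrite (ge0_integralZl_EFin _ measurableT g0E mgE u0') dE.
  have rhs : (\int[leb3 R]_x (fermi_density q tau (rho x) + (m * L ^+ 2 * B0)%:E * (g x)%:E) =
      (K + m * L ^+ 2 * B0 * d)%:E)%E.
    rewrite ge0_integralD; [|by []|by move=> x _; exact: j0|exact: mj| |]; last 2 first.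
    - by move=> x Tx; apply: mule_ge0; [rewrite lee_fin|exact: g0E].
    - exact: emeasurable_funM.
    rewrite KE EFinD [(_ * d)%:E]EFinM; congr (_ + _)%E.
    by rewrite (ge0_integralZl_EFin _ measurableT g0E mgE LB00) dE.
  rewrite -lee_fin -lhs -rhs; apply: ge0_le_integral.
  - by [].
  - by move=> x _; rewrite adde_ge0 ?j0// mule_ge0 ?lee_fin// addr_ge0 ?powR_ge0// mulr_ge0.
  - apply: emeasurable_funD; first exact: mj.
    apply: emeasurable_funM => //; apply: emeasurable_funD => //; exact: emeasurable_funM.
  - by apply: emeasurable_funD; [exact: mj|exact: emeasurable_funM].
  move=> x _.
  have -> : (c1%:E * ((g x `^ (4 / 3))%:E + u%:E * (g x)%:E) =
    (c1 * (g x `^ (4 / 3) + u * g x))%:E)%E by [].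
  have -> : ((m * L ^+ 2 * B0)%:E * (g x)%:E = (m * L ^+ 2 * B0 * (rho x - f x))%:E)%E by [].
  apply: le_trans (incrP (f0 x) (fr x)); apply: leeD2l; rewrite lee_fin LB1.
  have -> : 2 * n ^+ 2 * (K_cl q / Nstar `^ (2 / 3) + 66 * kappa) * (rho x `^ (4 / 3) - f x `^ (4 / 3)) =
    c1 * (2 * (rho x `^ (4 / 3) - f x `^ (4 / 3))) by rewrite /c1; ring.
  apply: ler_wpM2l => //; rewrite /g /f; case: (leP (rho x) (u ^+ 3)) => [_|/ltW].
    by rewrite !subrr powR0 ?mulr0 ?addr0// gt_eqF// divr_gt0.
  exact: pow43_incr.
have K1D : K - kappa * D <= K1 - kappa * D1.
  have n6 : 0 < n ^+ 3 ^+ 2 by rewrite exprn_gt0.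
  rewrite -(ler_pM2l n6); apply: le_trans sub.
  have e00 : 0 <= kappa * D - K.
    by apply: le_trans KD; apply: ltW; exact: energy_gap_gt0.
  rewrite -subr_ge0 (_ : _ - _ = (kappa * D - K) * (n ^+ 3 ^+ 2 - N1 ^+ 2)); last by ring.
  by rewrite mulr_ge0// subr_ge0 -Nd; move: (ltW d0); nra.
have Cst0 : 0 <= K_cl q / Nstar `^ (2 / 3) * n ^+ 2 * (u * d).
  apply: mulr_ge0; last by rewrite mulr_ge0 ?ltW.
  by apply: mulr_ge0 => //; exact: sqr_ge0.
have kH : 0 <= kappa * n ^+ 2 * H by rewrite mulr_ge0// mulr_ge0 ?sqr_ge0 ?ltW.
have := ltr_pM2r d0 (m * L ^+ 2 * B0) (33 * kappa * n ^+ 2 * u); rewrite Lu.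
move: KH; rewrite /c1 => KH.
move: K1D; rewrite DE => K1D; lra.
Qed.

End Fixed.
End Truncation.

(** * Radially decreasing densities *)

Section Radial.
Context {R : realType}.
Implicit Types (x y : R3 R) (f g h rho : R3 R -> R).

Lemma nbhs_boxP x (U : set (R3 R)) : nbhs (x : R * R * R) U <->
  exists2 e : R, 0 < e & forall y, `|x.1.1 - y.1.1| < e -> `|x.1.2 - y.1.2| < e ->
    `|x.2 - y.2| < e -> U y.
Proof.
split=> [/nbhs_ballP[e /= e0 eU]|[e e0 eU]].
  by exists e => // y y1 y2 y3; apply: eU; split; [split|].
by apply/nbhs_ballP; exists e => //= y [[/= y1 y2] /= y3]; exact: eU.
Qed.

Lemma enorm_axis (r : R) : 0 <= r -> enorm (r, 0, 0) = r.
Proof. by move=> r0; rewrite /enorm/= expr0n/= !addr0 sqrtr_sqr ger0_norm. Qed.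

Lemma coord_le_enorm x : `|x.1.1| <= enorm x.
Proof.
rewrite -(@ler_pXn2r _ 2)// ?nnegrE ?enorm_ge0// enorm_sqr real_normK ?num_real//.
by rewrite -addrA lerDl addr_ge0 ?sqr_ge0.
Qed.

Section Profile.
Variables (n : R) (rho : R3 R -> R) (g : R -> R).
Hypotheses (n0 : 0 < n) (r0 : forall x, 0 <= rho x) (mr : measurable_fun setT rho).
Hypothesis mass : (\int[leb3 R]_x (rho x)%:E = (n ^+ 3)%:E)%E.
Hypothesis gmon : forall r s, 0 < r -> r <= s -> g s <= g r.
Hypothesis rg : {ae leb3 R, forall x, rho x = g (enorm x)}.

(** A cube of side r / 4 with a corner at the origin lies in the ball of radius r / 2,
where rho >= g (r / 2), and it carries at most the mass n ^ 3. *)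
Lemma radial_decay (r : R) : 0 < r ->
  {ae leb3 R, forall y, r / 2 <= enorm y -> rho y <= 64 * n ^+ 3 / r ^+ 3}.
Proof.
move=> r1; have r2 : 0 < r / 2 by rewrite divr_gt0.
suff gv : g (r / 2) <= 64 * n ^+ 3 / r ^+ 3.
  by apply: filterS rg => y -> ry; apply: le_trans gv; exact: gmon.
have [v0|v0] := leP (g (r / 2)) 0.
  by apply: (le_trans v0); rewrite divr_ge0 ?exprn_ge0 ?mulr_ge0 ?exprn_ge0 ?ltW.
have r4 : 0 < r / 4 by rewrite divr_gt0.
have mQ := measurable_cube (r / 4).
have : ((g (r / 2))%:E * leb3 R (cube (r / 4)) <= (n ^+ 3)%:E)%E.
  rewrite -mass -int_indicZ ?(ltW v0)//; apply: ae_ge0_le_integral => //.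
  - by move=> x _; rewrite lee_fin mulr_ge0// ltW.
  - by apply/measurable_EFinP; apply: measurable_funM => //; exact: measurable_indic.
  - by move=> x _; rewrite lee_fin.
  - exact/measurable_EFinP.
  apply: filterS rg => x rx _; rewrite lee_fin indicE.
  have [/set_mem xQ|_] := boolP (x \in cube (r / 4)); last by rewrite mulr0.
  rewrite mulr1 rx; move: xQ; rewrite /cube/= !in_itv/=.
  move=> -[[/andP[x1 x1'] /andP[x2 x2']] /andP[x3 x3']].
  apply: gmon.
    by apply: lt_le_trans (coord_le_enorm x); rewrite gtr0_norm.
  rewrite le_enorm2 ?(ltW r2)// enorm_sqr.
  have aux (w : R) : 0 < w -> w < 0 + r / 4 -> w ^+ 2 <= (r / 4) ^+ 2.
    by move=> w0 wr; rewrite ler_pXn2r ?nnegrE ?ltW//; lra.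
  have -> : (r / 2) ^+ 2 = (r / 4) ^+ 2 + (r / 4) ^+ 2 + (r / 4) ^+ 2 + (r / 4) ^+ 2 by field.
  by rewrite ler_wpDr ?sqr_ge0//; apply: lerD; first apply: lerD; exact: aux.
rewrite leb3_cube ?(ltW r4)// -EFinM lee_fin => h.
rewrite ler_pdivlMr ?exprn_gt0//.
have -> : g (r / 2) * r ^+ 3 = 64 * (g (r / 2) * (r / 4) ^+ 3) by field.
by rewrite ler_wpM2l.
Qed.

Variable Rad : R.
Hypothesis RadP : support_radius rho Rad.

(** Otherwise the complement of the ball of radius r would be a neighbourhood of a point
of the support on which rho vanishes. *)
Lemma outer_mass (r : R) : 0 <= r -> r < Rad ->
  (\int[leb3 R]_x (rho x * \1_(~` [set y | (enorm y <= r)%R]) x)%:E != 0)%E.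
Proof.
move=> r1 rR; have [R0 sE] := RadP.
have mB : measurable (~` [set y : R3 R | enorm y <= r]).
  by apply: measurableC; exact: measurable_le_set measurable_enorm.
apply/negP => /eqP h0.
have inS : supp rho (Rad, 0, 0) by rewrite sE/= enorm_axis.
apply: (inS (~` [set y : R3 R | enorm y <= r])).
  apply/nbhs_boxP; exists (Rad - r); first by rewrite subr_gt0.
  move=> y /= y1 _ _; apply/negP; rewrite -ltNge.
  apply: lt_le_trans (coord_le_enorm y); apply: lt_le_trans (ler_norm _).
  by move: y1; rewrite ltr_norml => /andP[]; lra.
have mg : measurable_fun setT (fun x => rho x * \1_(~` [set y : R3 R | enorm y <= r]) x).
  by apply: measurable_funM => //; exact: measurable_indic.
have /ae_eq_integral_abs : (\int[leb3 R]_(x in setT)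
    `|(rho x * \1_(~` [set y | (enorm y <= r)%R]) x)%:E| = 0)%E.
  rewrite -[RHS]h0; apply: eq_integral => x _; rewrite /= ger0_norm//.
  by rewrite mulr_ge0.
move=> /(_ measurableT ((measurable_EFinP _ _).2 mg)).
by apply: filterS => x /(_ I) /= -[+] xr; rewrite indicE mem_set// mulr1.
Qed.

(** A point at distance s between Rad and r from the origin has a neighbourhood on which
rho vanishes, hence g vanishes at some distance below r, and beyond by monotonicity. *)
Lemma vanish_outside (r : R) : Rad < r -> {ae leb3 R, forall y, r <= enorm y -> rho y = 0}.
Proof.
move=> Rr; have [R0 sE] := RadP.
pose s := (Rad + r) / 2.
have s0 : 0 < s by rewrite divr_gt0//; lra.
have Rs : Rad < s by rewrite /s; lra.
have sr : s < r by rewrite /s; lra.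
clearbody s.
have nsupp : ~ supp rho (s, 0, 0).
  by rewrite sE/= enorm_axis ?(ltW s0)// => /(lt_le_trans Rs); rewrite ltxx.
have [U /not_implyP[/nbhs_boxP[e e0 eU] /contrapT rU]] : exists U : set (R3 R),
    ~ (nbhs ((s, 0, 0) : R * R * R) U -> ~ {ae leb3 R, forall y, U y -> rho y = 0}).
  by apply/existsNP => h; apply: nsupp.
pose t := Num.min e ((r - s) / 2).
have t0 : 0 < t by rewrite lt_min e0 divr_gt0// subr_gt0.
have te : t <= e by rewrite ge_min lexx.
have tr : 2 * t <= r - s.
  have : t <= (r - s) / 2 by rewrite ge_min lexx orbT.
  lra.
clearbody t.
have [N [mN N0 subN]] : {ae leb3 R, forall y, rho y = g (enorm y) /\ (U y -> rho y = 0)}.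
  by apply: filterS2 rg rU => y ? ?.
(* a box of positive measure cannot lie in the exceptional null set *)
pose Q : set (R3 R) := `]s, (s + t)[%classic `*` `]0, (0 + t)[%classic `*` `]0, (0 + t)[%classic.
have [y Qy Ny] : exists2 y, Q y & ~ N y.
  apply: contrapT => h; have QN : Q `<=` N.
    by move=> y Qy; apply: contrapT => Ny; apply: h; exists y.
  have mQ : measurable Q by apply: measurableX => //; exact: measurableX.
  have QN' : (leb3 R Q <= 0%:E)%E.
    by rewrite -[X in (_ <= X)%E]N0; apply: le_measure => //; rewrite inE.
  by move: QN'; rewrite leb3_cube ?(ltW t0)// lee_fin leNgt exprn_gt0.
have {Ny}[ry1 ry2] : rho y = g (enorm y) /\ (U y -> rho y = 0).
  by apply: contrapT => h; apply: Ny; exact: subN.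
move: Qy; rewrite /Q/= !in_itv/= => -[[/andP[y1 y1'] /andP[y2 y2']] /andP[y3 y3']].
have close (v w : R) : v < w -> w < v + t -> `|v - w| < e.
  move=> vw wv; rewrite distrC gtr0_norm ?subr_gt0// ltrBlDl.
  by apply: lt_le_trans wv _; rewrite lerD2l.
have Uy : U y by apply: eU; exact: close.
have gy : g (enorm y) = 0 by rewrite -ry1 ry2.
have ny0 : 0 < enorm y.
  by apply: lt_le_trans (coord_le_enorm y); rewrite gtr0_norm (lt_trans s0).
have yr : enorm y <= r.
  rewrite le_enorm2 ?enorm_sqr ?(ltW (lt_trans s0 sr))//.
  have -> : r ^+ 2 = (s + 2 * t + (r - s - 2 * t)) ^+ 2 by congr (_ ^+ 2); ring.
  have sq (v w : R) : 0 < v -> v <= w -> v ^+ 2 <= w ^+ 2.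
    by move=> v0 vw; rewrite ler_pXn2r ?nnegrE ?(ltW v0) ?(le_trans (ltW v0)).
  have a1 : y.1.1 ^+ 2 <= (s + t) ^+ 2 by apply: sq; [exact: lt_trans y1|exact: ltW].
  have a2 : y.1.2 ^+ 2 <= t ^+ 2 by apply: sq => //; rewrite -[t]add0r ltW.
  have a3 : y.2 ^+ 2 <= t ^+ 2 by apply: sq => //; rewrite -[t]add0r ltW.
  have a4 : (s + 2 * t) ^+ 2 <= (s + 2 * t + (r - s - 2 * t)) ^+ 2.
    apply: sq; first by rewrite addr_gt0// mulr_gt0.
    by rewrite lerDl subr_ge0.
  have a5 : 0 <= s * t by rewrite mulr_ge0 ?ltW.
  have a6 : 0 <= t ^+ 2 := sqr_ge0 t.
  apply: le_trans a4; rewrite !expr2 in a1 a2 a3 a6 *; lra.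
apply: filterS rg => z rz rz'; apply/eqP; rewrite eq_le r0 andbT rz -gy.
by apply: gmon => //; exact: le_trans rz'.
Qed.

(** At any radius r > Rad the ball carries all the mass: n ^ 3 <= 8 u ^ 3 r ^ 3, which
r = n / (4 u) violates. *)
Lemma radius_lower (u : R) : 0 < u -> {ae leb3 R, forall x, rho x <= u ^+ 3} ->
  n / (4 * u) <= Rad.
Proof.
move=> u0 ru; rewrite leNgt; apply/negP => Rr.
set r := n / (4 * u) in Rr.
have r1 : 0 < r by rewrite /r divr_gt0 ?mulr_gt0.
have u30 : 0 <= u ^+ 3 by rewrite exprn_ge0 ?ltW.
pose o : R3 R := (0, 0, 0).
have mB := measurable_eball o r.
have : ((n ^+ 3)%:E <= (u ^+ 3)%:E * leb3 R (eball o r))%E.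
  rewrite -mass -int_indicZ//; apply: ae_ge0_le_integral => //.
  - by move=> x _; rewrite lee_fin.
  - exact/measurable_EFinP.
  - by move=> x _; rewrite lee_fin mulr_ge0.
  - by apply/measurable_EFinP; apply: measurable_funM => //; exact: measurable_indic.
  apply: filterS2 ru (vanish_outside Rr) => x xu xr _; rewrite lee_fin indicE.
  have [_|/negP xB] := boolP (x \in eball _ _); first by rewrite mulr1.
  rewrite mulr0 xr// leNgt; apply/negP => h; apply: xB; rewrite inE /eball/=.
  have -> // : edist o x = enorm x.
  by rewrite edistC /edist /o/= !subr0; case: x {xu xr h} => -[].
have u30E : (0 <= (u ^+ 3)%:E)%E by rewrite lee_fin.
move=> /le_trans/(_ (lee_wpmul2l u30E (leb3_eball_le _ (ltW r1)))).
rewrite -EFinM lee_fin leNgt => /negP; apply.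
have -> : u ^+ 3 * (8 * r ^+ 3) = n ^+ 3 / 8 by rewrite /r; field; rewrite gt_eqF.
have : 0 < n ^+ 3 by exact: exprn_gt0.
lra.
Qed.

End Profile.
End Radial.

(** * The two dispersion relations *)

Section Dispersions.
Context {R : realType}.
Implicit Types (p : R3 R) (m c L : R).

Definition tau_rel m c p : R :=
  Num.sqrt (c ^+ 2 * enorm p ^+ 2 + m ^+ 2 * c ^+ 4) - m * c ^+ 2.

Definition tau_nonrel m p : R := enorm p ^+ 2 / (2 * m).

Lemma enorm_dilate a p : 0 <= a -> enorm (dilate a p) = a * enorm p.
Proof. exact: enormZ. Qed.

Lemma dispersion_nonrel m : 0 < m -> dispersion m (tau_nonrel m).
Proof.
move=> m0; split => //.
- apply: measurable_funM => //; apply: measurable_funX; exact: measurable_enorm.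
- by move=> p; rewrite divr_ge0 ?sqr_ge0// mulr_ge0// ltW.
- move=> a p a1; rewrite /tau_nonrel enorm_dilate ?(le_trans ler01)//.
  by rewrite exprMn mulrA.
Qed.

Lemma steep_nonrel m L : 0 < m -> steep m L (tau_nonrel m).
Proof.
move=> m0 p; rewrite /tau_nonrel ler_pdivlMr ?mulr_gt0//.
move: (enorm p) => e; have := sqr_ge0 (e - m * L); have := sqr_ge0 (m * L); nra.
Qed.

(** With M = m c ^ 2 and S the square root at p, the growth under dilations comes from
(a^2 S - (a^2 - 1) M) ^ 2 - (a^2 S^2 - (a^2 - 1) M^2) = a^2 (a^2 - 1) (S - M) ^ 2. *)
Lemma dispersion_rel m c : 0 < m -> 0 < c -> dispersion m (tau_rel m c).
Proof.
move=> m0 c0; have M0 : 0 < m * c ^+ 2 by rewrite mulr_gt0// exprn_gt0.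
have ME : m ^+ 2 * c ^+ 4 = (m * c ^+ 2) ^+ 2 by ring.
have rad0 p : 0 <= c ^+ 2 * enorm p ^+ 2 + (m * c ^+ 2) ^+ 2.
  by apply: addr_ge0; [apply: mulr_ge0; exact: sqr_ge0|exact: sqr_ge0].
split.
- apply: measurable_funB => //.
  have msqrt : measurable_fun setT (@Num.sqrt R).
    by apply: nondecreasing_measurable => // u v; exact: ler_wsqrtr.
  apply: (measurableT_comp msqrt); apply: measurable_funD => //.
  by apply: measurable_funM => //; apply: measurable_funX; exact: measurable_enorm.
- move=> p; rewrite /tau_rel ME subr_ge0 -[leLHS](ger0_norm (ltW M0)) -sqrtr_sqr.
  by apply: ler_wsqrtr; rewrite lerDr; apply: mulr_ge0; exact: sqr_ge0.
- move=> a p a1; have a0 := le_trans ler01 a1.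
  rewrite /tau_rel enorm_dilate// ME; set M := m * c ^+ 2.
  set S := Num.sqrt (c ^+ 2 * enorm p ^+ 2 + M ^+ 2).
  have S2 : S ^+ 2 = c ^+ 2 * enorm p ^+ 2 + M ^+ 2 by rewrite sqr_sqrtr.
  have S0 : 0 <= S by exact: sqrtr_ge0.
  have MS : M <= S.
    rewrite -[leLHS](ger0_norm (ltW M0)) -sqrtr_sqr; apply: ler_wsqrtr.
    by rewrite lerDr; apply: mulr_ge0; exact: sqr_ge0.
  have k0 : 0 <= a ^+ 2 - 1 by rewrite subr_ge0 expr_ge1.
  have T0 : 0 <= a ^+ 2 * S - (a ^+ 2 - 1) * M.
    have : (a ^+ 2 - 1) * M <= (a ^+ 2 - 1) * S by rewrite ler_wpM2l.
    by move=> ?; have : 0 <= S by []; lra.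
  rewrite lerBlDr; have -> : a ^+ 2 * (S - M) + M = a ^+ 2 * S - (a ^+ 2 - 1) * M by ring.
  rewrite -[leRHS]ger0_norm// -sqrtr_sqr; apply: ler_wsqrtr.
  have -> : c ^+ 2 * (a * enorm p) ^+ 2 + M ^+ 2 = a ^+ 2 * S ^+ 2 - (a ^+ 2 - 1) * M ^+ 2.
    by rewrite S2; ring.
  rewrite -subr_ge0.
  have -> : (a ^+ 2 * S - (a ^+ 2 - 1) * M) ^+ 2 - (a ^+ 2 * S ^+ 2 - (a ^+ 2 - 1) * M ^+ 2) =
    a ^+ 2 * ((a ^+ 2 - 1) * (S - M) ^+ 2) by ring.
  by apply: mulr_ge0; [exact: sqr_ge0|apply: mulr_ge0 => //; exact: sqr_ge0].
- move=> p; rewrite /tau_rel ME lerBlDr.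
  have h0 : 0 <= enorm p ^+ 2 / (2 * m) + m * c ^+ 2.
    apply: addr_ge0; last by apply: mulr_ge0; [exact: ltW|exact: sqr_ge0].
    by apply: divr_ge0; [exact: sqr_ge0|apply: mulr_ge0 => //; exact: ltW].
  rewrite -[leRHS]ger0_norm// -sqrtr_sqr; apply: ler_wsqrtr.
  have -> : (enorm p ^+ 2 / (2 * m) + m * c ^+ 2) ^+ 2 =
    c ^+ 2 * enorm p ^+ 2 + (m * c ^+ 2) ^+ 2 + (enorm p ^+ 2 / (2 * m)) ^+ 2.
    by field; rewrite gt_eqF.
  by rewrite lerDl sqr_ge0.
Qed.

(** With l = L / c, x = c |p| and M = m c ^ 2 the claim is
l x + (1 - l^2) M <= sqrt (x^2 + M^2), and the difference of the squares is
(1 - l^2) (x - l M) ^ 2 + l^2 M^2. *)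
Lemma steep_rel m c L : 0 < m -> 0 <= L -> L < c -> steep m L (tau_rel m c).
Proof.
move=> m0 L0 Lc p; have c0 := le_lt_trans L0 Lc.
rewrite /tau_rel lerBrDr; have e0 := enorm_ge0 p; move: (enorm p) e0 => e e0.
pose l := L / c.
have l0 : 0 <= l by rewrite divr_ge0// ltW.
have l1 : l <= 1 by rewrite /l ler_pdivrMr// mul1r ltW.
have LE : L = l * c by rewrite /l divfK// gt_eqF.
rewrite LE; clearbody l.
have -> : l * c * e - m * (l * c) ^+ 2 + m * c ^+ 2 = l * (c * e) + (1 - l ^+ 2) * (m * c ^+ 2) by ring.
have -> : c ^+ 2 * e ^+ 2 + m ^+ 2 * c ^+ 4 = (c * e) ^+ 2 + (m * c ^+ 2) ^+ 2 by ring.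
have l2 : 0 <= l ^+ 2 <= 1 by rewrite sqr_ge0 expr_le1.
have M0 : 0 <= m * c ^+ 2 by apply: mulr_ge0; [exact: ltW|exact: sqr_ge0].
have x0 : 0 <= c * e by rewrite mulr_ge0// ltW.
move: (c * e) (m * c ^+ 2) x0 M0 => x M x0 M0.
case/andP: l2 => l20 l21.
have h0 : 0 <= l * x + (1 - l ^+ 2) * M by rewrite addr_ge0 ?mulr_ge0// subr_ge0.
rewrite -[leLHS]ger0_norm// -sqrtr_sqr; apply: ler_wsqrtr.
rewrite -subr_ge0.
have -> : x ^+ 2 + M ^+ 2 - (l * x + (1 - l ^+ 2) * M) ^+ 2 =
  (1 - l ^+ 2) * (x - l * M) ^+ 2 + l ^+ 2 * M ^+ 2 by ring.
apply: addr_ge0; apply: mulr_ge0; rewrite ?sqr_ge0//.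
by rewrite subr_ge0.
Qed.

End Dispersions.

(** * The bounds for one minimizer, and the theorem *)

Section MainBounds.
Context {R : realType}.
Variables (kappa q m p n A Nstar : R) (tau : R3 R -> R).
Hypotheses (kappa0 : 0 < kappa) (q0 : 0 < q) (m0 : 0 < m) (n0 : 0 < n).
Hypotheses (p43 : 4 / 3 <= p) (tauP : dispersion m tau).
Hypothesis A0 : 0 < A.
Hypothesis AP : forall s, 0 <= s -> (fermi_density q tau s <= (A * s `^ (5 / 3))%:E)%E.
Hypotheses (Nstar0 : 0 < Nstar) (cb : coulomb_bound kappa q Nstar).
Variables (rho : R3 R -> R) (Rad : R).
Hypothesis rhoP : minimizes kappa q tau p (n ^+ 3) rho.
Hypotheses (symP : symmetric_decreasing rho) (radP : support_radius rho Rad).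

Let r0 := minimizer_ge0 rhoP.
Let mr := minimizer_measurable p43 rhoP.
Let mass := minimizer_mass rhoP.

(** [potential_le] on balls of radius r / 2, where [radial_decay] applies, bounds the
potential outside the ball of radius r by P = (32 * 64 / 4 + 2) n ^ 3 / r;
[potential_lower] applied to the outer part then bounds r. *)
Lemma radius_upper : Rad <= (64 * 514 * A) / kappa / n.
Proof.
have [g [gmon rg]] := symP.
rewrite leNgt; apply/negP; set b := (64 * 514 * A) / kappa / n => bR.
have b0 : 0 < b.
  apply: (divr_gt0 _ n0); apply: (divr_gt0 _ kappa0); apply: (mulr_gt0 _ A0).
  by apply: mulr_gt0; rewrite ltr0n.
pose r := (b + Rad) / 2.
have br : b < r by rewrite /r; lra.
have rR : r < Rad by rewrite /r; lra.
clearbody r.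
have r1 : 0 < r := lt_trans b0 br.
have n30 : 0 < n ^+ 3 by exact: exprn_gt0.
pose B : set (R3 R) := [set y | enorm y <= r].
have mB : measurable B by exact: measurable_le_set measurable_enorm.
pose f x := rho x * \1_B x; pose h x := rho x * \1_(~` B) x.
have mf : measurable_fun setT f by apply: measurable_funM => //; exact: measurable_indic.
have mh : measurable_fun setT h.
  by apply: measurable_funM => //; apply: measurable_indic; exact: measurableC.
have f0 x : 0 <= f x by rewrite mulr_ge0.
have h0 x : 0 <= h x by rewrite mulr_ge0.
have fh x : f x + h x = rho x.
  rewrite /f /h !indicE in_setC; case: (x \in B); rewrite /= ?mulr1 ?mulr0 ?addr0 ?add0r//.
have h1 := outer_mass r0 mr radP (ltW r1) rR.
pose P := 514 * n ^+ 3 / r.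
have P0 : 0 <= P.
  by apply: (divr_ge0 _ (ltW r1)); apply: (mulr_ge0 _ (ltW n30)); rewrite ler0n.
have hP x : h x != 0 -> (potential rho x <= P%:E)%E.
  rewrite /h indicE; case: (boolP (x \in ~` B)) => [/set_mem xB _|]; last by rewrite mulr0 eqxx.
  have {}xB : r < enorm x by rewrite ltNge; apply/negP.
  have r2 : 0 < r / 2 by rewrite divr_gt0.
  have t0 : 0 <= 64 * n ^+ 3 / r ^+ 3.
    by apply: divr_ge0; [apply: mulr_ge0 => //; exact: ltW|apply: exprn_ge0; exact: ltW].
  have dec : {ae leb3 R, forall y, eball x (r / 2) y -> rho y <= 64 * n ^+ 3 / r ^+ 3}.
    apply: filterS (radial_decay n0 r0 mr mass gmon rg r1) => y + xy; apply.
    rewrite leNgt; apply/negP => yr.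
    have x2 : r ^+ 2 < enorm x ^+ 2 by rewrite ltr_pXn2r// nnegrE ?enorm_ge0// ltW.
    have y2 : enorm y ^+ 2 < (r / 2) ^+ 2 by rewrite -lt_enorm2// ltW.
    have d2 : edist x y ^+ 2 < (r / 2) ^+ 2.
      by rewrite ltr_pXn2r// nnegrE ?edist_nonneg// ltW.
    (* |x| ^ 2 <= 2 |x - y| ^ 2 + 2 |y| ^ 2 replaces the triangle inequality *)
    have tri (u v : R) : u ^+ 2 <= 2 * (u - v) ^+ 2 + 2 * v ^+ 2.
      by have := sqr_ge0 (u - 2 * v); nra.
    move: x2 y2 d2; rewrite edist_sqr !enorm_sqr.
    have := tri x.1.1 y.1.1; have := tri x.1.2 y.1.2; have := tri x.2 y.2.
    have -> : (r / 2) ^+ 2 = r ^+ 2 / 4 by field.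
    lra.
  apply: le_trans (potential_le mr r0 r2 t0 dec) _.
  rewrite mass -EFinM -EFinD lee_fin /P le_eqVlt; apply/orP; left; apply/eqP.
  by field; rewrite gt_eqF.
have := potential_lower kappa0 q0 n0 p43 tauP A0 AP Nstar0 cb rhoP mf mh f0 h0 fh h1 P0 hP.
rewrite /P ler_pdivlMr// leNgt => /negP; apply.
have -> : 514 * n ^+ 3 = kappa / (64 * A) * n ^+ 4 * b.
  by rewrite /b; field; rewrite !gt_eqF.
by rewrite ltr_pM2l// mulr_gt0 ?exprn_gt0// divr_gt0// mulr_gt0.
Qed.

Variables (B0 B1 : R).
Hypotheses (B00 : 0 < B0) (B10 : 0 < B1).
(** beta n ^ 2 is the slope L that [ess_bound_upper] asks for; at the height
u = gamma n ^ 2 the error coefficient m L ^ 2 B0 is kappa n ^ 2 u. *)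
Let beta := 2 * (K_cl q / Nstar `^ (2 / 3) + 66 * kappa) / B1.
Let gamma := m * beta ^+ 2 * B0 / kappa.
Hypothesis incrP : forall s t, 0 <= t -> t <= s ->
  (fermi_density q tau t + (beta * n ^+ 2 * B1 * (s `^ (4 / 3) - t `^ (4 / 3)))%:E <=
   fermi_density q tau s + (m * (beta * n ^+ 2) ^+ 2 * B0 * (s - t))%:E)%E.

Let leb3T : (0 < leb3 R setT)%E.
Proof.
apply: (@lt_le_trans _ _ (leb3 R (cube 1))).
  by rewrite leb3_cube// expr1n lte_fin.
by apply: le_measure; rewrite ?inE//; exact: measurable_cube.
Qed.

Let sup_leP (t : R) : ('N[leb3 R]_+oo [EFin \o rho] <= t%:E)%E <->
  {ae leb3 R, forall x, rho x <= t}.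
Proof.
rewrite unlock leb3T; split=> [/ess_supP|h].
  by apply: filterS => x; rewrite /= lee_fin ger0_norm.
by apply/ess_supP; apply: filterS h => x; rewrite /= lee_fin ger0_norm.
Qed.

(** 2112 is twice the constant of [ess_bound_lower], which turns its non-strict bound
into a contradiction. *)
Lemma minimizer_bounds : 0 < beta ->
  [/\ (((kappa / (2112 * A)) ^+ 3 * (n ^+ 3) ^+ 2)%:E <= 'N[leb3 R]_+oo [EFin \o rho])%E,
      ('N[leb3 R]_+oo [EFin \o rho] <= (gamma ^+ 3 * (n ^+ 3) ^+ 2)%:E)%E,
      (4 * gamma)^-1 / n <= Rad & Rad <= (64 * 514 * A) / kappa / n].
Proof.
move=> beta0.
have gamma0 : 0 < gamma by rewrite divr_gt0// mulr_gt0// mulr_gt0// exprn_gt0.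
have n2 : 0 < n ^+ 2 by exact: exprn_gt0.
pose u := gamma * n ^+ 2; have u0 : 0 < u by rewrite mulr_gt0.
have cube6 (c : R) : c ^+ 3 * (n ^+ 3) ^+ 2 = (c * n ^+ 2) ^+ 3 by ring.
have LB1 : beta * n ^+ 2 * B1 = 2 * n ^+ 2 * (K_cl q / Nstar `^ (2 / 3) + 66 * kappa).
  by rewrite /beta; field; rewrite !gt_eqF// powR_gt0.
have LB0 : 0 < m * (beta * n ^+ 2) ^+ 2 * B0.
  by rewrite mulr_gt0// mulr_gt0// exprn_gt0// mulr_gt0.
have ru : {ae leb3 R, forall x, rho x <= u ^+ 3}.
  apply: (ess_bound_upper kappa0 q0 n0 p43 tauP A0 AP Nstar0 cb LB1 LB0 incrP rhoP u0).
  have -> : m * (beta * n ^+ 2) ^+ 2 * B0 = kappa * n ^+ 2 * u.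
    by rewrite /u /gamma; field; rewrite gt_eqF.
  have X : 0 < kappa * n ^+ 2 * u by rewrite mulr_gt0// mulr_gt0.
  lra.
split.
- rewrite leNgt; apply/negP => /ltW; rewrite cube6 => /sup_leP ru'.
  have c0 : 0 < kappa / (2112 * A).
    by apply: (divr_gt0 kappa0); apply: (mulr_gt0 _ A0); rewrite ltr0n.
  have := ess_bound_lower kappa0 q0 n0 p43 tauP A0 AP Nstar0 cb rhoP (mulr_gt0 c0 n2) ru'.
  rewrite ler_pM2r//; apply/negP; rewrite -ltNge.
  have -> : kappa / (1056 * A) = 2 * (kappa / (2112 * A)) by field; rewrite gt_eqF.
  lra.
- by rewrite cube6; apply/sup_leP.
- have [g [gmon rg]] := symP.
  apply: le_trans (radius_lower n0 r0 mr mass gmon rg radP u0 ru).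
  by rewrite /u le_eqVlt; apply/orP; left; apply/eqP; field; rewrite !gt_eqF.
- exact: radius_upper.
Qed.

End MainBounds.

Unset Implicit Arguments.

Theorem theorem1p5 (R : realType) (kappa q m Nstar : R)
    (kappa_gt0 : 0 < kappa) (q_ge1 : 1 <= q) (m_gt0 : 0 < m)
    (NstarP : is_Nstar kappa q Nstar) :
  exists C1 C2 : R, 0 < C1 /\ C1 <= C2 /\
    forall N : R, 0 < N ->
      (forall (rho : R3 R -> R) (Rad : R),
         minimizer_infty kappa q m N rho ->
         symmetric_decreasing rho -> support_radius rho Rad ->
         ((C1 * N ^+ 2)%:E <= 'N[leb3 R]_+oo [EFin \o rho]
                           <= (C2 * N ^+ 2)%:E)%E /\
         C1 * N `^ (- (1 / 3)) <= Rad <= C2 * N `^ (- (1 / 3)))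
      /\
      (exists c0 : R, forall c : R, c0 < c ->
         0 < N `^ (2 / 3) < c * Nstar `^ (2 / 3) ->
         forall (rho : R3 R -> R) (Rad : R),
           minimizer_c kappa q m c N rho ->
           symmetric_decreasing rho -> support_radius rho Rad ->
           ((C1 * N ^+ 2)%:E <= 'N[leb3 R]_+oo [EFin \o rho]
                             <= (C2 * N ^+ 2)%:E)%E /\
           C1 * N `^ (- (1 / 3)) <= Rad <= C2 * N `^ (- (1 / 3))).
Proof.
have q0 : 0 < q by exact: lt_le_trans ltr01 q_ge1.
have [Nstar0 cb _] := NstarP.
pose A := kinetic_const q m; have A0 : 0 < A := kinetic_const_gt0 q0 m_gt0.
pose B1 := q / (8 * pi ^+ 3) * moment 1 * (6 * pi ^+ 2 / q) `^ (4 / 3).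
pose B0 := q / (8 * pi ^+ 3) * moment 0 * (6 * pi ^+ 2 / q).
have cq0 : 0 < q / (8 * pi ^+ 3) :> R.
  by apply: divr_gt0 => //; apply: mulr_gt0 => //; apply: exprn_gt0; exact: pi_gt0.
have B10 : 0 < B1.
  by apply: mulr_gt0; [apply: mulr_gt0 => //; exact: moment_gt0|apply: powR_gt0; exact: fermi_const_gt0].
have B00 : 0 < B0.
  by apply: mulr_gt0; [apply: mulr_gt0 => //; exact: moment_gt0|exact: fermi_const_gt0].
pose beta := 2 * (K_cl q / Nstar `^ (2 / 3) + 66 * kappa) / B1.
have beta0 : 0 < beta.
  apply: divr_gt0 => //; apply: mulr_gt0 => //; apply: ltr_wpDl; last exact: mulr_gt0.
  apply: divr_ge0; last exact: powR_ge0.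
  by apply: mulr_ge0; [exact: divr_ge0|exact: powR_ge0].
pose gamma := m * beta ^+ 2 * B0 / kappa.
have gamma0 : 0 < gamma.
  apply: divr_gt0 => //; apply: mulr_gt0 => //; apply: mulr_gt0 => //; exact: exprn_gt0.
pose a1 := (kappa / (2112 * A)) ^+ 3; pose a2 := (4 * gamma)^-1.
pose b1 := gamma ^+ 3; pose b2 := 64 * 514 * A / kappa.
have a10 : 0 < a1.
  by apply: exprn_gt0; apply: (divr_gt0 kappa_gt0); apply: (mulr_gt0 _ A0); rewrite ltr0n.
have a20 : 0 < a2 by rewrite invr_gt0 mulr_gt0.
have b10 : 0 < b1 by exact: exprn_gt0.
have b20 : 0 < b2.
  apply: (divr_gt0 _ kappa_gt0); apply: (mulr_gt0 _ A0).
  by apply: mulr_gt0; rewrite ltr0n.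
have bounds (n : R) (tau : R3 R -> R) p rho Rad : 0 < n -> dispersion m tau ->
    steep m (beta * n ^+ 2) tau -> 4 / 3 <= p ->
    minimizes kappa q tau p (n ^+ 3) rho -> symmetric_decreasing rho ->
    support_radius rho Rad ->
    [/\ ((a1 * (n ^+ 3) ^+ 2)%:E <= 'N[leb3 R]_+oo [EFin \o rho])%E,
      ('N[leb3 R]_+oo [EFin \o rho] <= (b1 * (n ^+ 3) ^+ 2)%:E)%E,
      a2 / n <= Rad & Rad <= b2 / n].
  move=> n0 tauP st p43 rhoP sy su.
  apply: (minimizer_bounds kappa_gt0 q0 m_gt0 n0 p43 tauP A0 _ Nstar0 cb rhoP sy su B00 B10 _ beta0).
    by move=> s s0; exact: (fermi_density_le q0 m_gt0 tauP).
  move=> s t t0 ts; apply: (fermi_density_incr q0 m_gt0 tauP _ st t0 ts).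
  by apply: mulr_gt0 => //; exact: exprn_gt0.
pose C1 := Num.min a1 a2; pose C2 := C1 + b1 + b2.
have C10 : 0 < C1 by rewrite lt_min a10.
have C1a1 : C1 <= a1 by rewrite ge_min lexx.
have C1a2 : C1 <= a2 by rewrite ge_min lexx orbT.
have b1C2 : b1 <= C2 by rewrite /C2; lra.
have b2C2 : b2 <= C2 by rewrite /C2; lra.
exists C1, C2; split => //; split; first by rewrite /C2; lra.
move=> N N0; pose n := N `^ (1 / 3).
have n0 : 0 < n by exact: powR_gt0.
have nN : N = n ^+ 3.
  rewrite /n -powR_mulrn ?powR_ge0// -powRrM (_ : 1 / 3 * 3%:R = 1); last by field.
  by rewrite powRr1// ltW.
have Nn : N `^ (- (1 / 3)) = n^-1 by rewrite powRN.
have in_terms_of_N (rho : R3 R -> R) Rad :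
    [/\ ((a1 * (n ^+ 3) ^+ 2)%:E <= 'N[leb3 R]_+oo [EFin \o rho])%E,
      ('N[leb3 R]_+oo [EFin \o rho] <= (b1 * (n ^+ 3) ^+ 2)%:E)%E,
      a2 / n <= Rad & Rad <= b2 / n] ->
    ((C1 * N ^+ 2)%:E <= 'N[leb3 R]_+oo [EFin \o rho] <= (C2 * N ^+ 2)%:E)%E /\
     C1 * N `^ (- (1 / 3)) <= Rad <= C2 * N `^ (- (1 / 3)).
  rewrite -nN Nn => -[h1 h2 h3 h4].
  have N2 : 0 <= N ^+ 2 by exact: sqr_ge0.
  have n1 : 0 <= n^-1 by rewrite invr_ge0 ltW.
  split; apply/andP; split.
  - by apply: le_trans h1; rewrite lee_fin ler_wpM2r.
  - by apply: (le_trans h2); rewrite lee_fin ler_wpM2r.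
  - by apply: le_trans h3; rewrite ler_wpM2r.
  - by apply: (le_trans h4); rewrite ler_wpM2r.
split=> [rho Rad [ad en] sy su|].
  have p43 : 4 / 3 <= 5 / 3 :> R by lra.
  apply: in_terms_of_N; apply: (bounds n _ _ _ _ n0 (dispersion_nonrel m_gt0) (steep_nonrel _ m_gt0) p43 _ sy su).
  rewrite -nN; split; [exact: ad|move=> rho' ad'].
  apply: (@le_trans _ _ (E_infty kappa q m N)); first by rewrite -en.
  by apply: ereal_inf_lbound; exists rho'.
(* c0 is the slope L, for steep_rel to apply *)
exists (beta * n ^+ 2) => c cc _ rho Rad [ad en] sy su.
have L0 : 0 < beta * n ^+ 2 by apply: mulr_gt0 => //; exact: exprn_gt0.
have disp := dispersion_rel m_gt0 (lt_trans L0 cc).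
have st := steep_rel m_gt0 (ltW L0) cc.
apply: in_terms_of_N; apply: (bounds n _ _ _ _ n0 disp st (lexx _) _ sy su).
rewrite -nN; split; [exact: ad|move=> rho' ad'].
apply: (@le_trans _ _ (E_c kappa q m c N)); first by rewrite -en.
by apply: ereal_inf_lbound; exists rho'.
Qed.
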